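(* Let $r,D,m$ be positive integers and $K=\frac{D(D^2+6D+1)}{2}$. There is a constant $C=C(r,D,m)>0$ such that for every positive integer $n$ the following holds: if $H$ is an $r$-uniform quasi-algebraic hypergraph of complexity $(D,m)$ on $N\ge\mathrm{tw}_K(Cn)$ vertices, then $H$ contains a clique or an independent set of size $n$.
   Context: The tower function: $\mathrm{tw}_1(x)=x$, $\mathrm{tw}_k(x)=2^{\mathrm{tw}_{k-1}(x)}$. For an ordered set $A$, $A^{(k)}=\{(a_1,\dots,a_k)\in A^k:a_1<\dots<a_k\}$; for $a\in A^r$ and $I\subset[r]$, $a_I=(a_i)_{i\in I}$. A function $f:A^{(r)}\to\mathbb{R}$ is $D$-dependent if there exist functions $\phi_I:A^{(D)}\to\mathbb{R}$, $I\in[r]^{(D)}$, with $f(a)=\sum_{I\in[r]^{(D)}}\phi_I(a_I)$ for all $a\in A^{(r)}$. Quasi-algebraic hypergraph of complexity $(D,m)$: let $A$ be a finite totally ordered set, $f_1,\dots,f_m:A^{(r)}\to\mathbb{R}$ be $D$-dependent functions, and $\Gamma:\{\texttt{false},\texttt{true}\}^m\to\{\texttt{false},\texttt{true}\}$ a Boolean formula; the $r$-uniform hypergraph on $A$ in which $a\in A^{(r)}$ is an edge iff $\Gamma(f_1(a)\le0,\dots,f_m(a)\le0)=\texttt{true}$, and any hypergraph isomorphic to it, is quasi-algebraic of complexity $(D,m)$. A clique is a vertex set all of whose $r$-subsets are edges; an independent set contains no edge. *)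

(* Defs.v *)
From HB Require Import structures.
From Stdlib Require Import Reals.
From mathcomp Require Import all_boot all_order all_algebra.
From mathcomp Require Import Rstruct.
Set Implicit Arguments. Unset Strict Implicit. Unset Printing Implicit Defensive.
Import Order.TTheory GRing.Theory Num.Theory.
Local Open Scope ring_scope.

(* Tower function: tw 1 x = x, tw (k+1) x = 2^(tw k x) (real exponent).
   tw 0 x := x is an irrelevant convention. *)
Fixpoint tw (k : nat) (x : R) : R :=
  match k with
  | O => x
  | S O => x
  | S k' => Rpower 2 (tw k' x)
  end.

Definition incr (k N : nat) (a : 'I_k -> 'I_N) : Prop :=
  forall i j : 'I_k, (i < j)%N -> (a i < a j)%N.

(* Boolean version for index tuples I in [r]^(D), seen as increasing maps
   'I_D -> 'I_r; a_I is then a \o I. *)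
Definition incrb (D r : nat) (s : {ffun 'I_D -> 'I_r}) : bool :=
  [forall i : 'I_D, forall j : 'I_D, (i < j)%N ==> (s i < s j)%N].

Definition D_dependent (r D N : nat) (f : ('I_r -> 'I_N) -> R) : Prop :=
  exists phi : {ffun 'I_D -> 'I_r} -> ('I_D -> 'I_N) -> R,
    forall a : 'I_r -> 'I_N, incr a ->
      f a = \sum_(s : {ffun 'I_D -> 'I_r} | incrb s) phi s (fun i => a (s i)).

Definition r_uniform (V : finType) (r : nat) (E : {set {set V}}) : Prop :=
  forall e, e \in E -> #|e| = r.

(* Quasi-algebraic of complexity (D,m): r-uniform and isomorphic (via the
   bijection g) to the hypergraph on the ordered set 'I_#|V| whose edges are the
   increasing r-tuples a with Gamma(f_1(a) <= 0, ..., f_m(a) <= 0). *)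
Definition quasi_algebraic (V : finType) (r D m : nat) (E : {set {set V}}) : Prop :=
  r_uniform r E /\
  exists (g : 'I_#|V| -> V) (f : 'I_m -> ('I_r -> 'I_#|V|) -> R)
         (Gamma : ('I_m -> bool) -> bool),
    bijective g /\
    (forall j, D_dependent D (f j)) /\
    forall a : 'I_r -> 'I_#|V|, incr a ->
      ([set g (a i) | i : 'I_r] \in E) = Gamma (fun j => f j a <= 0).

Definition is_clique (V : finType) (r : nat) (E : {set {set V}}) (S : {set V}) : Prop :=
  forall e : {set V}, e \subset S -> #|e| = r -> e \in E.

Definition is_independent (V : finType) (E : {set {set V}}) (S : {set V}) : Prop :=
  forall e : {set V}, e \in E -> ~~ (e \subset S).

(* Main.v *)
(** After Ramsey's theorem for (2d+1)-tuples, the d-fold mixed differences of a function F of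
    d variables all have the same sign, and in each coordinate k the unit mixed differences
    mu(z) grow or decay geometrically.  Summing mu over the orthant z_k < x_k (growing k),
    z_k >= x_k (decaying k), intersected with the region where the coordinates of z increase with
    gaps, gives a function equal to F modulo functions of fewer variables, and
    comparable to the term at the corner of the orthant; hence it changes by a large factor
    whenever one variable moves (it is lacunary).  Descending from d = D to d = 1 turns
    f(a) = sum_I phi_I(a_I) into a sum of functions G_L(a_L), |L| <= D, with G_L lacunary in every
    variable of L.  A last application of Ramsey's theorem, to 2D-tuples, makes any two of them
    comparable in a uniform way; lacunarity excludes ties, so one term G_L dominates the sum for
    all a, and f has constant sign.  The rounds cost a tower of height D^2 + 3D <= K, independent
    of r since mixed differences of a D-ary function never involve more than 2D + 1 points. *)

Require Import Defs.
From HB Require Import structures.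
From Stdlib Require Import Reals.
From mathcomp Require Import all_boot all_order all_algebra.
From mathcomp Require Import Rstruct.
From Stdlib Require Import FunctionalExtensionality.
From mathcomp Require Import zify ring lra.
Set Implicit Arguments. Unset Strict Implicit. Unset Printing Implicit Defensive.
Import Order.TTheory GRing.Theory Num.Theory.

(** * Towers and Ramsey's theorem *)

Fixpoint twn (k x : nat) : nat :=
  match k with
  | 0 | 1 => x
  | S k' => 2 ^ twn k' x
  end.

Lemma twnSS k x : twn k.+2 x = 2 ^ twn k.+1 x.
Proof. by []. Qed.

Lemma twn_mono k x y : x <= y -> twn k x <= twn k y.
Proof.
move=> xy; elim: k => [|[|k] IH] //.
by rewrite !twnSS leq_exp2l.
Qed.

Lemma twn_ge k x : x <= twn k x.
Proof.
elim: k => [|[|k] IH] //; rewrite twnSS.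
by apply: leq_trans IH (ltnW (ltn_expl _ _)).
Qed.

Lemma twn_monok k l x : 0 < k -> k <= l -> twn k x <= twn l x.
Proof.
case: k => // k _; elim: l => // l IH; rewrite leq_eqVlt => /orP[/eqP -> //|].
rewrite ltnS => kl; apply: leq_trans (IH kl) _.
case: l kl {IH} => // l _; rewrite twnSS; exact: ltnW (ltn_expl _ _).
Qed.

Lemma twn_comp a b x : 0 < a -> 0 < b -> twn a (twn b x) = twn (a + b).-1 x.
Proof.
case: a => // a _; case: b => // b _; elim: a => [|a IH] //.
rewrite twnSS IH !addSn /= addnS //.
Qed.

(** Absorbs a constant factor into the argument of the tower: at each exponential, $c\,2^t\le
    2^{ct}$ for $t\ge1$. *)
Lemma mul_twn b c x : 0 < b -> 0 < c -> 0 < x -> c * twn b x <= twn b (c * x).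
Proof.
case: b => // b _ c0 x0; elim: b => // b IH; rewrite !twnSS.
apply: (@leq_trans (2 ^ (c * twn b.+1 x))); last by rewrite leq_exp2l.
have t0 : 0 < twn b.+1 x by apply: leq_trans x0 (twn_ge _ _).
case: c c0 {IH} => // c _; rewrite [c.+1 * twn _ _]mulSn expnD mulnC; apply: leq_mul => //.
apply: (@leq_trans (2 ^ c)); first exact: ltn_expl.
by rewrite leq_exp2l // leq_pmulr.
Qed.

Section EndHomogeneous.
Variables (A : eqType) (T : finType) (s : nat) (chi : seq A -> T).

Lemma big_fibre (X : finType) (f : A -> X) (S : seq A) k :
  0 < #|X| -> 0 < k -> #|X| * k <= size S -> exists c, k <= size [seq y <- S | f y == c].
Proof.
move=> X0 k0 kS; apply/existsP; apply: contraLR kS; rewrite negb_exists => /forallP h.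
rewrite -ltnNge.
have -> : size S = \sum_c size [seq y <- S | f y == c].
  elim: S {h} => [|y S IH] /=; first by rewrite big1.
  rewrite (eq_bigr (fun c => (f y == c) + size [seq y <- S | f y == c])); last first.
    by move=> c _; case: eqP.
  rewrite big_split /= -IH (bigD1 (f y)) //= eqxx big1 // => c; by rewrite eq_sym => /negbTE ->.
apply: (@leq_ltn_trans (\sum_(c : X) k.-1)).
  by apply: leq_sum => c _; move: (h c); rewrite -ltnNge; case: (k) k0.
by rewrite sum_nat_const ltn_mul2l X0; case: (k) k0 => //=.
Qed.

(** The Erdős-Rado notion: the colour of a tuple does not depend on its last entry. [c] is the
    prefix already chosen by a greedy construction, [l] the part added after it. *)
Definition end_homogeneous (c l : seq A) := forall l1 l2 u y y',
  l = l1 ++ l2 -> size u = s -> subseq u (c ++ l1) -> y \in l2 -> y' \in l2 ->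
  chi (rcons u y) = chi (rcons u y').
End EndHomogeneous.

Lemma subseq_rconsE (A : eqType) (u c : seq A) x :
  subseq u (rcons c x) -> subseq u c \/ exists2 v, u = rcons v x & subseq v c.
Proof.
case/lastP: u => [|v y]; first by left; exact: sub0seq.
rewrite -(subseq_rev) !rev_rcons /=; case: eqP => [->|_] h.
  by right; exists v => //; rewrite -subseq_rev.
by left; rewrite -subseq_rev rev_rcons.
Qed.

Lemma subseq_rcons_split (A : eqType) (u : seq A) y l : subseq (rcons u y) l ->
  exists l1 l2, [/\ l = l1 ++ l2, subseq u l1 & y \in l2].
Proof.
elim: l u => [|x l IH] u; first by case: u.
case: u => [|z u] /=.
  by move=> h; exists [::], (x :: l); split=> //; move: h; case: eqP => [->|_];
      rewrite ?mem_head // sub1seq inE => ->; rewrite orbT.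
case: eqP => [->|_] h.
  have [l1 [l2 [-> h1 h2]]] := IH _ h; exists (x :: l1), l2; split => //=; by rewrite eqxx.
have [l1 [l2 [-> h1 h2]]] := IH (z :: u) h; exists (x :: l1), l2; split => //.
by apply: subseq_trans h1 (subseq_cons _ _).
Qed.

(** Greedy choice: the head [x] of [S] moves to the prefix, and [S] is thinned to a class of points
    that no tuple ending in [x] tells apart. The prefix stays within [t] points, so [Q] bounds the
    number of classes. The last hypothesis is the invariant for tuples inside the prefix. *)
Lemma end_homogeneous_exists (A : eqType) (T : finType) s (chi : seq A -> T) t Q k (c S : seq A) :
  Q = #|T| ^ (t ^ s) -> 0 < #|T| -> size c + k <= t -> (2 * Q) ^ k <= size S ->
  (forall u y y', size u = s.+1 -> subseq u c -> y \in S -> y' \in S ->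
     chi (rcons u y) = chi (rcons u y')) ->
  exists l, [/\ subseq l S, size l = k & end_homogeneous s.+1 chi c l].
Proof.
move=> QE T0; have Q0 : 0 < Q by rewrite QE expn_gt0 T0.
elim: k c S => [|k IH] c S.
  move=> _ _ _; exists [::]; split=> //; first exact: sub0seq.
  by move=> l1 l2 u y y'; case: l1 => //= <-.
case: S => [|x S] ct; first by rewrite leqNgt expn_gt0 muln_gt0 Q0.
move=> Ssz inv.
(* [f y] lists the colours of all $(w,x,y)$ with $w$ an $s$-tuple of positions in [c]; positions
   past the end of [c] read the default [x] and only add harmless entries. *)
pose f y : {ffun s.-tuple 'I_t -> T} :=
  [ffun w : s.-tuple 'I_t => chi (rcons (rcons [seq nth x c (val i) | i <- val w] x) y)].
have [a ha] : exists a, (2 * Q) ^ k <= size [seq y <- S | f y == a].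
  apply: big_fibre; [by rewrite card_ffun expn_gt0 T0| by rewrite expn_gt0 muln_gt0 Q0|].
  rewrite card_ffun card_tuple card_ord -QE.
  (* In the factor [2 * Q], [Q] pays for the classes and 2 for the removed head. *)
  move: Ssz; rewrite expnS /=; have : 0 < (2 * Q) ^ k by rewrite expn_gt0 muln_gt0 Q0.
  nia.
set S' := [seq y <- S | _] in ha.
have S'S : {subset S' <= S} by move=> y; rewrite mem_filter => /andP[].
have [||l [lS lk lh]] := IH (rcons c x) S' _ ha.
- by rewrite size_rcons addSnnS.
- move=> u y y' us uc yS yS'.
  case: (subseq_rconsE uc) => [uc'|[v uE vc]].
    by apply: inv => //; rewrite inE S'S ?orbT.
  move: us; rewrite uE size_rcons => -[vs].
  have it z : z \in v -> index z c < t.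
    by move=> /(mem_subseq vc); rewrite -index_mem; lia.
  pose w : seq 'I_t := pmap insub [seq index z c | z <- v].
  have wE : [seq val i | i <- w] = [seq index z c | z <- v].
    rewrite /w; elim: (v) it => //= z v' IHv it.
    rewrite (insubT (fun i => i < t) (it z (mem_head _ _))) /= IHv // => z' z'v.
    by apply: it; rewrite inE z'v orbT.
  have ws : size w == s by rewrite -(size_map val) wE size_map vs.
  have vE : v = [seq nth x c (val i) | i <- w].
    rewrite (map_comp (nth x c) val) wE -map_comp -[LHS]map_id; apply/eq_in_map => z zv /=.
    by rewrite nth_index // (mem_subseq vc).
  move: yS yS'; rewrite !mem_filter => /andP[/eqP fy _] /andP[/eqP fy' _].
  by have := congr1 (fun g : {ffun _ -> _} => g (Tuple ws)) (etrans fy (esym fy'));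
      rewrite !ffunE /= -vE.
exists (x :: l); split => /=.
- by rewrite eqxx; apply: subseq_trans lS (filter_subseq _ _).
- by rewrite lk.
- move=> [|x' l1] l2 u y y' /=.
    move=> <-; rewrite cats0 => us uc yl yl'; apply: inv => //.
      by move: yl; rewrite !inE => /orP[->//|/(mem_subseq lS)/S'S ->]; rewrite orbT.
    by move: yl'; rewrite !inE => /orP[->//|/(mem_subseq lS)/S'S ->]; rewrite orbT.
  move=> [<- le] us uc; apply: lh le us _; by rewrite cat_rcons.
Qed.

Definition homogeneous (A : eqType) (T : Type) (chi : seq A -> T) s (l : seq A) :=
  forall u u', size u = s -> size u' = s -> subseq u l -> subseq u' l -> chi u = chi u'.

(** Induction on [s] from the pigeonhole principle: in an end-homogeneous sequence, replacing the
    last entry of a tuple by the final point [z] keeps its colour, which leaves a colouring of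
    tuples shorter by one. Each step costs one exponential. *)
Lemma ramsey_seq s q : 0 < s -> exists C, 0 < C /\ forall n, 0 < n ->
  forall (A : eqType) (T : finType) (chi : seq A -> T) (S : seq A), 0 < #|T| -> #|T| <= 2 ^ q ->
  twn s (C * n) <= size S ->
  exists l, [/\ subseq l S, size l = n & homogeneous chi s l].
Proof.
case: s => // s _; elim: s => [|s [C [C0 IH]]].
  exists (2 ^ q); split; first by rewrite expn_gt0.
  move=> n n0 A T chi S T0 Tq /= nS.
  have [a ha] := @big_fibre A T (fun y => chi [:: y]) S n T0 n0 (leq_trans (leq_mul Tq (leqnn n)) nS).
  exists (take n [seq y <- S | chi [:: y] == a]); split.
  - exact: subseq_trans (take_subseq _ _) (filter_subseq _ _).
  - by rewrite size_takel.
  - move=> [|y [|//]] [|y' [|//]] // _ _; rewrite !sub1seq => /mem_take + /mem_take.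
    by rewrite !mem_filter => /andP[/eqP -> _] /andP[/eqP -> _].
exists ((q + 2 * s.+1 + 1) * (C + 1)); split; first by rewrite muln_gt0 !addn1.
move=> n n0 A T chi S T0 Tq nS.
(* The extra 1 is for [z]; the other points are those that the induction hypothesis asks for. *)
set t := (twn s.+1 (C * n)).+1.
have [||] := @end_homogeneous_exists A T s chi t _ t [::] S erefl T0 (leqnn _).
- apply: leq_trans nS; rewrite twnSS.
  apply: (@leq_trans (2 ^ ((q + 1) * t ^ s.+1))).
    apply: (@leq_trans ((2 * 2 ^ (q * t ^ s)) ^ t)).
      by rewrite leq_exp2r // leq_mul2l /= expnM leq_exp2r // expn_gt0.
    rewrite -expnS -expnM leq_exp2l //.
    have := expnS t s; have : 0 < t ^ s by rewrite expn_gt0.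
    nia.
  (* For [s = 0] everything is linear in [n]. Otherwise $t=2^v+1\le2^{v+1}$, so the left side is at
     most 2 to a constant multiple of $v$, and [mul_twn] absorbs the constant. *)
  rewrite leq_exp2l // /t; case: (s) => [|s'].
    rewrite /= expn1; nia.
  rewrite !twnSS; set v := twn s'.+1 _.
  have v0 : 0 < v by apply: leq_trans (twn_ge _ _); rewrite muln_gt0 C0.
  apply: (@leq_trans (2 ^ (q + (v + 1) * s'.+2))).
    rewrite expnD; apply: leq_mul; first by rewrite addn1; exact: ltn_expl.
    rewrite expnM leq_exp2r // addn1 expnS.
    have : 0 < 2 ^ v by rewrite expn_gt0.
    lia.
  rewrite leq_exp2l //; apply: (@leq_trans ((q + 2 * s'.+2) * v)); first by nia.
  apply: leq_trans (mul_twn _ _ _) _ => //; first by rewrite addn_gt0 orbT.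
    by rewrite muln_gt0 C0.
  apply: twn_mono; rewrite mulnA leq_mul2r; apply/orP; right; nia.
- by move=> [|a u] //.
move=> l [lS lt eh].
case/lastP: l lt lS eh => [|l z] //; rewrite size_rcons => -[lt] lS eh.
have [//|l' [l'l l'n hom]] := IH n n0 A T (fun u => chi (rcons u z)) l T0 Tq _.
  by rewrite lt.
exists l'; split => //.
  by apply: subseq_trans l'l (subseq_trans (subseq_rcons _ _) lS).
have key u y : size u = s.+1 -> subseq (rcons u y) l' -> chi (rcons u y) = chi (rcons u z).
  move=> us uy; have [l1 [l2 [le ul yl]]] := subseq_rcons_split (subseq_trans uy l'l).
  apply: (eh l1 (rcons l2 z)) => //; rewrite ?mem_rcons ?inE ?yl ?eqxx ?orbT //.
  by rewrite le rcons_cat.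
move=> u u'; case/lastP: u => // u y; case/lastP: u' => // u' y'.
rewrite !size_rcons => -[us] [us'] uy uy'.
rewrite (key u y) ?(key u' y') //.
by apply: hom => //; [apply: subseq_trans (subseq_rcons _ _)
    uy|apply: subseq_trans (subseq_rcons _ _) uy'].
Qed.

(** * Order-invariant form of Ramsey's theorem *)

Definition embeds (n M : nat) (e : nat -> nat) :=
  (forall x y, x < y -> y < n -> e x < e y) /\ (forall x, x < n -> e x < M).

Definition increasing_on (n : nat) (u : seq nat) (b : nat -> nat) :=
  sorted ltn (map b u) /\ all (gtn n) (map b u).

Lemma subseq_iota_sorted N v : sorted ltn v -> all (gtn N) v -> subseq v (iota 0 N).
Proof.
move=> vs vN; suff -> : v = [seq x <- iota 0 N | x \in v] by exact: filter_subseq.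
apply: (irr_sorted_eq ltn_trans ltnn vs).
  by apply: sorted_filter (iota_ltn_sorted _ _); exact: ltn_trans.
move=> x; rewrite mem_filter mem_iota /= add0n.
by case xv: (x \in v) => //=; have /= -> := allP vN _ xv.
Qed.

(** Each test [P c] reads at most [s] points, so it suffices to colour [s]-tuples by the vector of
    all test results and to pass to a homogeneous set. *)
Lemma ramsey_order_invariant (s : nat) (I : finType) (u : I -> seq nat) :
  0 < s -> (forall c, uniq (u c)) -> (forall c, size (u c) <= s) ->
  exists C, 0 < C /\ forall n, 0 < n -> forall M, twn s (C * n) <= M ->
  forall P : I -> (nat -> nat) -> bool,
  (forall c b b', {in u c, b =1 b'} -> P c b = P c b') ->
  exists e, embeds n M e /\
  forall c b b', increasing_on n (u c) b -> increasing_on n (u c) b' -> P c (e \o b) = P c (e \o b').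
Proof.
move=> s0 uu us; have [C [C0 HC]] := ramsey_seq #|I| s0.
exists (C * (1 + s)); split; first by rewrite muln_gt0 C0.
move=> n n0 M nM P Pdep.
(* Test [c] reads the first entries of [v] in the order of [u c]; the later entries are padding. *)
pose chi (v : seq nat) : {ffun I -> bool} := [ffun c => P c (fun w => nth 0 v (index w (u c)))].
have [||||l [lM ln hom]] := HC (n + s) _ nat {ffun I -> bool} chi (iota 0 M).
- by rewrite addn_gt0 n0.
- by rewrite card_ffun card_bool expn_gt0.
- by rewrite card_ffun card_bool.
- rewrite size_iota; apply: leq_trans nM; apply: twn_mono; rewrite -mulnA leq_mul2l.
  by apply/orP; right; nia.
have lsorted : sorted ltn l.
  by apply: (subseq_sorted ltn_trans lM); exact: iota_ltn_sorted.
pose e := nth 0 l.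
have e_incr x y : x < y -> y < n + s -> e x < e y.
  by move=> xy yn; apply: (sorted_ltn_nth ltn_trans 0 lsorted) => //; rewrite inE ln // (ltn_trans xy).
exists e; split.
  split=> [x y xy yn|x xn]; first by apply: e_incr => //; lia.
  have : nth 0 l x \in l by rewrite mem_nth // ln; lia.
  by move/(mem_subseq lM); rewrite mem_iota.
(* The [s] points from [n] on are reserved as padding: they lie above all values of [b], so every
   list extends to an increasing [s]-tuple. *)
pose v c (b : nat -> nat) := map b (u c) ++ iota n (s - size (u c)).
have vsub c b : increasing_on n (u c) b -> subseq (map e (v c b)) l.
  move=> [bs bn].
  have -> : l = map e (iota 0 (n + s)) by rewrite -ln map_nth_iota0 ?take_size.
  apply: map_subseq; apply: subseq_iota_sorted.
    rewrite /v (sorted_pairwise ltn_trans) pairwise_cat -!(sorted_pairwise ltn_trans)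
        bs iota_ltn_sorted !andbT.
    apply/allrelP => x y /(allP bn) /= xn; rewrite mem_iota => /andP[ny _].
    exact: leq_trans xn ny.
  rewrite /v all_cat; apply/andP; split.
    by apply/allP => x /(allP bn) /= xn; apply: leq_trans xn (leq_addr _ _).
  apply/allP => x; rewrite mem_iota /=; move: (us c); lia.
have vsz c b : size (map e (v c b)) = s.
  by rewrite size_map size_cat size_map size_iota; move: (us c); lia.
have PE c b : P c (e \o b) = chi (map e (v c b)) c.
  rewrite ffunE; apply: Pdep => w wu /=.
  have iw : index w (u c) < size (u c) by rewrite index_mem.
  rewrite (nth_map 0); last by rewrite size_cat size_map; lia.
  by rewrite nth_cat size_map iw (nth_map 0) // nth_index.
move=> c b b' hb hb'; rewrite !PE; congr (fun_of_fin _ _).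
by apply: hom; rewrite ?vsz //; exact: vsub.
Qed.

Local Open Scope ring_scope.

(** * Mixed differences *)

Definition upd d (x : 'I_d -> nat) (k : 'I_d) (v : nat) : 'I_d -> nat :=
  fun i => if i == k then v else x i.

Definition agree_off d (k : 'I_d) (x y : 'I_d -> nat) := forall i, i != k -> x i = y i.

(** The product of the one-variable difference operators, expanded over the vertices of the box with
    sides from [lo] to [hi]. *)
Definition mixed_diff (R : pzRingType) d (F : ('I_d -> nat) -> R) (lo hi : 'I_d -> nat) : R :=
  \sum_(t : {ffun 'I_d -> bool})
    (\prod_i (if t i then 1 else -1)) * F (fun i => if t i then hi i else lo i).

Lemma mixed_diff_comp (R : pzRingType) d (F : ('I_d -> nat) -> R) e lo hi :
  mixed_diff (fun x => F (e \o x)) lo hi = mixed_diff F (e \o lo) (e \o hi).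
Proof.
apply: eq_bigr => t _; congr (_ * F _); apply: functional_extensionality => i /=.
by case: (t i).
Qed.

Section MixedDifference.
Variables (R : comNzRingType) (d : nat) (F : ('I_d -> nat) -> R).

Lemma eval_sum N (x : 'I_d -> nat) : (forall i, (x i < N)%N) ->
  F x = \sum_(y : {ffun 'I_d -> 'I_N}) F (fun i => y i) * \prod_i (y i == x i :> nat)%:R.
Proof.
move=> xN; pose y0 := [ffun i => Ordinal (xN i)].
rewrite (bigD1 y0) //= big1 ?mulr1; last by move=> i _; rewrite ffunE /= eqxx.
rewrite big1 ?addr0; first by congr F; apply: functional_extensionality => i; rewrite ffunE.
move=> y yy0; have [i yi] : exists i, (y i != x i :> nat).
  apply/existsP; apply: contraNT yy0; rewrite negb_exists => /forallP h.
  by apply/eqP/ffunP => i; apply: val_inj; rewrite ffunE /=; apply/eqP; move: (h i); rewrite negbK.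
by rewrite (bigD1 i) //= (negbTE yi) mul0r mulr0.
Qed.

(** Writing [F] as a sum of point masses reduces to products of one-variable functions, for which
    the alternating sum factors by distributivity. *)
Lemma mixed_diffE N (lo hi : 'I_d -> nat) : (forall i, (lo i < N)%N) -> (forall i, (hi i < N)%N) ->
  mixed_diff F lo hi = \sum_(y : {ffun 'I_d -> 'I_N})
     F (fun i => y i) * \prod_i ((y i == hi i :> nat)%:R - (y i == lo i :> nat)%:R).
Proof.
move=> lN hN; rewrite /mixed_diff.
under eq_bigr => t _.
  rewrite (@eval_sum N); last by move=> i; case: (t i).
  rewrite mulr_sumr; over.
rewrite exchange_big /=; apply: eq_bigr => y _.
have -> : \prod_i ((y i == hi i :> nat)%:R - (y i == lo i :> nat)%:R) =
   \prod_i \sum_(b : bool) (if b then 1 else -1) * (y i == (if b then hi i else lo i) :> nat)%:R :> R.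
  by apply: eq_bigr => i _; rewrite big_bool /= mul1r mulN1r.
rewrite bigA_distr_bigA mulr_sumr; apply: eq_bigr => t _.
by rewrite big_split /=; ring.
Qed.

(** Additivity when the [k]-th side is cut at [q]: in the product form only factor [k] differs, and
    there the differences telescope. *)
Lemma mixed_diff_split (lo hi : 'I_d -> nat) k q r :
  mixed_diff F lo (upd hi k r) = mixed_diff F lo (upd hi k q) + mixed_diff F (upd lo k q) (upd hi k r).
Proof.
pose N := (\sum_i (lo i + hi i) + q + r).+1.
have le i : (lo i + hi i <= \sum_i (lo i + hi i))%N by rewrite (bigD1 i) //= leq_addr.
have loN i : (lo i < N)%N by move: (le i); rewrite /N; lia.
have hiN i : (hi i < N)%N by move: (le i); rewrite /N; lia.
have uN x v : (forall i, (x i < N)%N) -> (v < N)%N -> forall i, (upd x k v i < N)%N.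
  by move=> xN vN i; rewrite /upd; case: eqP.
have qN : (q < N)%N by rewrite /N; lia.
have rN : (r < N)%N by rewrite /N; lia.
rewrite !(@mixed_diffE N) //; try exact: uN.
rewrite -big_split /=; apply: eq_bigr => y _; rewrite -mulrDr; congr (_ * _).
rewrite !(bigD1 k (P := predT)) //= /upd !eqxx.
have E (p p' : nat) : \prod_(i < d | i != k)
    ((y i == (if i == k then p else hi i) :> nat)%:R - (y i == (if i == k then p' else lo i) :> nat)%:R)
  = \prod_(i < d | i != k) ((y i == hi i :> nat)%:R - (y i == lo i :> nat)%:R) :> R.
  by apply: eq_bigr => i /negbTE ->.
have E' (p : nat) : \prod_(i < d | i != k)
    ((y i == (if i == k then p else hi i) :> nat)%:R - (y i == lo i :> nat)%:R)
  = \prod_(i < d | i != k) ((y i == hi i :> nat)%:R - (y i == lo i :> nat)%:R) :> R.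
  by apply: eq_bigr => i /negbTE ->.
by rewrite E !E'; ring.
Qed.
End MixedDifference.

Section Telescoping.
Variable R : comNzRingType.

Lemma prod_sub_telescope d (a b : 'I_d -> R) :
  \prod_i a i = \prod_i b i +
    \sum_(j < d) ((\prod_(i < d | (i < j)%N) a i) * (a j - b j) * \prod_(i < d | (j < i)%N) b i).
Proof.
elim: d a b => [|d IH] a b; first by rewrite !big_ord0 addr0.
rewrite big_ord_recl (IH (fun i => a (lift ord0 i)) (fun i => b (lift ord0 i))).
rewrite [X in _ = X + _]big_ord_recl [X in _ = _ + X]big_ord_recl.
rewrite [X in X * (a ord0 - _)]big_pred0 //.
have -> : \prod_(i < d.+1 | (@ord0 d < i)%N) b i = \prod_(i < d) b (lift ord0 i).
  by rewrite big_mkcond big_ord_recl /= mul1r; apply: eq_bigr.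
rewrite mulrDr mulr_sumr mul1r mulrBl addrA [b ord0 * _ + _]addrC subrK; congr (_ + _).
apply: eq_bigr => j _.
have -> : \prod_(i < d.+1 | (i < lift ord0 j)%N) a i = a ord0 * \prod_(i < d | (i < j)%N)
    a (lift ord0 i).
  rewrite big_mkcond big_ord_recl /= [in RHS]big_mkcond; congr (_ * _); apply: eq_bigr => i _.
have -> : \prod_(i < d.+1 | (lift ord0 j < i)%N) b i = \prod_(i < d | (j < i)%N) b (lift ord0 i).
  rewrite big_mkcond big_ord_recl /= mul1r [in RHS]big_mkcond; apply: eq_bigr => i _.
  by [].
ring.
Qed.

(** Each [H k] ignores coordinate [k], so it is a function of one variable fewer, which the descent
    passes on to the next level. *)
Definition eq_mod_lower d (D : ('I_d -> nat) -> Prop) (F G : ('I_d -> nat) -> R) :=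
  exists H : 'I_d -> ('I_d -> nat) -> R,
    (forall (k : 'I_d) x y, agree_off k x y -> H k x = H k y) /\
    (forall x, D x -> F x = G x + \sum_k H k x).

Lemma eq_mod_lower_sym d D (F G : ('I_d -> nat) -> R) : eq_mod_lower D F G -> eq_mod_lower D G F.
Proof.
move=> [H [Hk HE]]; exists (fun k x => - H k x); split; first by move=> k x y /Hk ->.
by move=> x Dx; rewrite (HE x Dx) sumrN addrK.
Qed.

Lemma eq_mod_lower_trans d D (F G K : ('I_d -> nat) -> R) :
  eq_mod_lower D F G -> eq_mod_lower D G K -> eq_mod_lower D F K.
Proof.
move=> [H [Hk HE]] [H' [Hk' HE']]; exists (fun k x => H k x + H' k x).
split; first by move=> k x y xy; rewrite (Hk k x y xy) (Hk' k x y xy).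
by move=> x Dx; rewrite (HE x Dx) (HE' x Dx) big_split /= [X in _ = _ + X]addrC addrA.
Qed.

(* Factor [k] of [B] may only look at coordinates before [k]: then the term of the
   telescoping sum at [j] ignores coordinate [j]. *)
Lemma sum_prod_eq_mod_lower d (D : ('I_d -> nat) -> Prop) (Z : finType) (nu : Z -> R) (A : 'I_d ->
    nat -> Z -> R)
   (B : 'I_d -> ('I_d -> nat) -> Z -> R) :
  (forall (k : 'I_d) x y z, (forall i : 'I_d, (i < k)%N -> x i = y i) -> B k x z = B k y z) ->
  eq_mod_lower D (fun x => \sum_z nu z * \prod_k (A k (x k) z - B k x z))
                 (fun x => \sum_z nu z * \prod_k A k (x k) z).
Proof.
move=> Bk.
exists (fun (j : 'I_d) x => \sum_z nu z * ((\prod_(i < d | (i < j)%N) (A i (x i)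
    z - B i x z)) * - B j x z
                      * \prod_(i < d | (j < i)%N) A i (x i) z)).
split.
  move=> k x y xy; apply: eq_bigr => z _; congr (_ * (_ * - _ * _)).
  - apply: eq_bigr => i ik; rewrite (xy i) ?(Bk i x y) //; last by rewrite -val_eqE /=; lia.
    by move=> j ji; apply: xy; rewrite -val_eqE /=; lia.
  - by apply: Bk => i ik; apply: xy; rewrite -val_eqE /=; lia.
  - by apply: eq_bigr => i ik; rewrite (xy i) //; rewrite -val_eqE /=; lia.
move=> x _; rewrite exchange_big -big_split /=; apply: eq_bigr => z _.
rewrite -mulr_sumr -mulrDr (prod_sub_telescope _ (fun k => A k (x k) z)); congr (_ * (_ + _)).
by apply: eq_bigr => j _; congr (_ * _ * _); ring.
Qed.
End Telescoping.

(** * Lacunary part of a function *)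

Definition increasing d (x : 'I_d -> nat) := forall i j : 'I_d, (i < j)%N -> (x i < x j)%N.

(** The sides from [x i] to [x i + 1] of the unit box are disjoint and in order, so their endpoints
    form an increasing tuple. Boolean, since it serves as an indicator in sums. *)
Definition gapped d (x : 'I_d -> nat) : bool :=
  [forall i : 'I_d, forall j : 'I_d, (i < j)%N ==> ((x i).+1 < x j)%N].

Lemma gappedP d (x : 'I_d -> nat) :
  reflect (forall i j : 'I_d, (i < j)%N -> ((x i).+1 < x j)%N) (gapped x).
Proof.
apply: (iffP forallP) => [h i j|h i]; first by move/forallP: (h i) => /(_ j)/implyP.
by apply/forallP => j; apply/implyP; apply: h.
Qed.

Section GeometricSums.
Variable R : realFieldType.

Lemma sum_half_up M x :
  \sum_(v < M) (x <= v)%N%:R * 2^-1 ^+ (v - x) <= 2 - 2 * 2^-1 ^+ (M - x) :> R.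
Proof.
elim: M => [|M IH]; first by rewrite big_ord0 sub0n expr0 mulr1 subrr.
rewrite big_ord_recr /=; apply: le_trans (lerD IH (lexx _)) _.
case: leqP => xM; last first.
  have [-> ->] : (M.+1 - x = 0 /\ M - x = 0)%N by clear -xM; lia.
  by rewrite mul0r addr0.
rewrite subSn // exprS mul1r; move: (2^-1 ^+ (M - x)) => h; lra.
Qed.

Lemma sum_half_down M x :
  \sum_(v < M) (v < x)%N%:R * 2^-1 ^+ (x.-1 - v) <= 2 * 2^-1 ^+ (x - M) :> R.
Proof.
elim: M => [|M IH]; first by rewrite big_ord0 mulr_ge0 // exprn_ge0 // invr_ge0.
rewrite big_ord_recr /=; apply: le_trans (lerD IH (lexx _)) _.
case: ltnP => xM; last first.
  have [-> ->] : (x - M.+1 = 0 /\ x - M = 0)%N by clear -xM; lia.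
  by rewrite mul0r addr0.
have [-> ->] : (x - M = (x - M.+1).+1 /\ x.-1 - M = x - M.+1)%N by clear -xM; lia.
rewrite mul1r exprS; move: (2^-1 ^+ (x - M.+1)) => h; lra.
Qed.
End GeometricSums.

Definition ndist (a b : nat) := ((a - b) + (b - a))%N.

Section Integration.
Variables (R : realFieldType) (d M : nat) (F : ('I_d -> nat) -> R) (lam : R) (up : 'I_d -> bool).
Let mu (z : 'I_d -> nat) := mixed_diff F z (fun i => (z i).+1).
Hypothesis lam2 : 2 <= lam.
Hypothesis mu_sign : exists b : bool, forall z, gapped z -> (forall i, z i < M)%N ->
  mu z = (-1) ^+ b * `|mu z|.
Hypothesis mu_step : forall k z, let z' := upd z k (z k).+1 in
  gapped z -> gapped z' -> (forall i, z' i < M)%N ->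
  if up k then lam * `|mu z| <= `|mu z'| else lam * `|mu z'| <= `|mu z|.

(** Since $-[v\le z]=[z<v]-1$, both forms have the same difference in [v]; the choice of orthant
    alters the integral only by functions missing a coordinate. *)
Let factor k (v : nat) (z : {ffun 'I_d -> 'I_M}) : R :=
  if up k then (z k < v)%N%:R else - (v <= z k)%N%:R.
Let integral (x : 'I_d -> nat) : R :=
  \sum_(z : {ffun 'I_d -> 'I_M}) ((gapped (fun i => z i))%:R * mu (fun i =>
      z i)) * \prod_k factor k (x k) z.
Let domain (x : 'I_d -> nat) := increasing x /\ forall i, (x i <= M)%N.

Lemma sum_delta_below (y x : nat) : 
  \sum_(c < M) ((y == c.+1)%:R - (y == c :> nat)%:R) * (c < x)%N%:R = (y == minn x M)%:R - (y == 0)%:R :> R.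
Proof.
elim: (M) => [|M' IH]; first by rewrite big_ord0 minn0 subrr.
rewrite big_ord_recr /= IH; case: (ltnP M' x) => xM.
  by rewrite (minn_idPr xM) mulr1; ring.
by rewrite (minn_idPl (leqW xM)) mulr0 addr0.
Qed.

(** Discrete fundamental theorem of calculus: summing unit mixed differences over the box below [x]
    leaves the mixed difference between 0 and [x]. *)
Lemma sum_mu_below (x : 'I_d -> nat) : (forall i, x i <= M)%N ->
  \sum_(z : {ffun 'I_d -> 'I_M}) mu (fun i => z i) * \prod_k (z k < x k)%N%:R =
  \sum_(y : {ffun 'I_d -> 'I_M.+1}) F (fun i =>
      y i) * \prod_k ((y k == x k :> nat)%:R - (y k == 0 :> nat)%:R).
Proof.
move=> xM.
under eq_bigr => z _.
  rewrite /mu (@mixed_diffE _ _ _ M.+1); last 2 first.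
  - by move=> i; apply: leqW.
  - by move=> i; rewrite ltnS.
  rewrite mulr_suml; over.
rewrite exchange_big /=; apply: eq_bigr => y _.
under eq_bigr do rewrite -mulrA -big_split /=.
rewrite -mulr_sumr; congr (_ * _).
rewrite -(bigA_distr_bigA (fun k (c : 'I_M) =>
    ((y k == c.+1 :> nat)%:R - (y k == c :> nat)%:R) * (c < x k)%N%:R)).
by apply: eq_bigr => k _; rewrite sum_delta_below (minn_idPl (xM k)).
Qed.

(** Three replacements modulo fewer variables: [F] by its mixed difference from 0 to [x], then by a
    sum over [z] interleaved with [x], then by the sum over gapped [z] in the chosen orthant. In
    each, the correction at [k] sees only earlier coordinates. *)
Lemma eq_mod_lower_integral : eq_mod_lower domain F integral.
Proof.
pose G1 x := \sum_(y : {ffun 'I_d -> 'I_M.+1}) F (fun i =>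
    y i) * \prod_k ((y k == x k :> nat)%:R - (y k == 0 :> nat)%:R).
have FG1 : eq_mod_lower domain F G1.
  have [H [Hk HE]] := eq_mod_lower_sym (@sum_prod_eq_mod_lower R d domain _
    (fun y : {ffun 'I_d -> 'I_M.+1} => F (fun i => y i)) (fun k v y => (y k == v :> nat)%:R)
    (fun k x y => (y k == 0 :> nat)%:R) (fun k x y z _ => erefl)).
  exists H; split=> // x Dx; rewrite -HE // -eval_sum // => i.
  by rewrite ltnS; case: Dx.
(* Flags that $z_k$ is not beyond some earlier $x_i$. As [x] is increasing, subtracting it from
   $[z_k<x_k]$ leaves the indicator of $z_k<x_k$ and $x_i<z_k$ for all $i<k$. *)
pose early (k : 'I_d) (x : 'I_d -> nat) (z : {ffun 'I_d -> 'I_M}) : R :=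
  [exists i : 'I_d, (i < k)%N && (z k <= x i)%N]%:R.
have earlyE (k : 'I_d) (x y : 'I_d -> nat) z : (forall i : 'I_d, (i < k)%N -> x i = y i) ->
    early k x z = early k y z.
  move=> xy; congr (nat_of_bool _)%:R; apply: eq_existsb => i.
  by case ik: (i < k)%N => //=; rewrite xy.
pose nu (z : {ffun 'I_d -> 'I_M}) := mu (fun i => z i).
pose G2 x := \sum_(z : {ffun 'I_d -> 'I_M}) nu z * \prod_k ((z k < x k)%N%:R - early k x z).
have G12 : eq_mod_lower domain G1 G2.
  have [H [Hk HE]] := eq_mod_lower_sym (@sum_prod_eq_mod_lower R d domain _ nu 
    (fun k v z => (z k < v)%N%:R) early earlyE).
  exists H; split=> // x Dx; rewrite -HE // /G1 -sum_mu_below //.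
  by case: Dx.
apply: eq_mod_lower_trans FG1 (eq_mod_lower_trans G12 _).
have [|H [Hk HE]] := @sum_prod_eq_mod_lower R d domain _ 
    (fun z : {ffun 'I_d -> 'I_M} => (gapped (fun i => z i))%:R * nu z) factor (fun k x z =>
        early k x z - (~~ up k)%:R).
  by move=> k x y z xy; rewrite (earlyE k x y).
exists H; split=> // x Dx; rewrite -HE //; apply: eq_bigr => z _.
have E k : (z k < x k)%N%:R - early k x z = factor k (x k) z - (early k x z - (~~ up k)%:R).
  rewrite /factor; case: (up k) => /=; first by ring.
  by rewrite ltnNge; case: leqP => _ /=; ring.
(* If the product is nonzero, then $z_i<x_i<z_j$ for $i<j$, so [z] is gapped: inserting the
   indicator of gapped [z] changes nothing. *)
rewrite (eq_bigr _ (fun k _ => E k)); case: (boolP (gapped _)) => [|ng]; first by rewrite mul1r.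
rewrite mul0r mul0r -(eq_bigr _ (fun k _ => E k)).
apply/eqP; rewrite mulf_eq0; apply/orP; right; apply: contraNT ng => /prodf_neq0 nz.
have nz' k : (z k < x k)%N /\ forall i : 'I_d, (i < k)%N -> (x i < z k)%N.
  have := nz k isT; rewrite /early; case: existsP => [[i /andP[ik zk]]|ne].
    by rewrite (leq_ltn_trans zk) ?subrr ?eqxx //; case: Dx => Dx _; apply: Dx.
  case: leqP => [_|zk _]; first by rewrite subrr eqxx.
  split=> // i ik; rewrite ltnNge; apply/negP => zi; apply: ne; exists i; by rewrite ik.
apply/gappedP => i j ij; have [zi _] := nz' i; have [_ /(_ i ij)] := nz' j.
exact: leq_ltn_trans.
Qed.

(** A path of unit steps from [z] to [c], each in the growing direction of its coordinate, gains
    [lam] per step. The steps are ordered so that every point on the way stays gapped. *)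
Lemma mu_path n (z c : 'I_d -> nat) : gapped z -> gapped c ->
  (forall i, z i < M)%N -> (forall i, c i < M)%N ->
  (forall k, if up k then z k <= c k else c k <= z k)%N ->
  (\sum_k ndist (z k) (c k))%N = n -> lam ^+ n * `|mu z| <= `|mu c|.
Proof.
elim: n z => [|n IH] z zg cg zM cM zc sn.
  rewrite expr0 mul1r; have -> // : z = c.
  apply: functional_extensionality => k.
  have /forallP/(_ k) : [forall k, ndist (z k) (c k) == 0%N].
    by move/eqP: sn; rewrite sum_nat_eq0.
  by rewrite /ndist => /eqP; lia.
have lam0 : 0 <= lam by apply: le_trans lam2.
have updn k v : ndist (z k) (c k) = (ndist v (c k)).+1 -> (\sum_j ndist (upd z k v j) (c j))%N = n.
  move=> e; apply: succn_inj; rewrite -sn (bigD1 k) //= [RHS](bigD1 k) //= e /upd eqxx addSn;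
      congr (_ + _).+1.
  by apply: eq_bigr => i /negbTE ->.
have [/existsP[k0 k0P]|/existsPn noup] := boolP [exists k, z k < c k]%N.
  (* Among the coordinates still to go up, move the last: all later ones are at or above their
     targets, so the gaps of [c] leave room. *)
  have [k zk kmax] := @arg_maxnP _ k0 (fun k => z k < c k)%N (fun k => nat_of_ord k) k0P.
  have uk : up k by have := zc k; case: (up k) => //; lia.
  have z'g : gapped (upd z k (z k).+1).
    apply/gappedP => i j ij; rewrite /upd; move/gappedP: (zg) => /(_ i j ij) g.
    case: (i =P k) => [ik|ik]; case: (j =P k) => [jk|jk]; subst => //; try lia.
    have : ~~ (z j < c j)%N by apply/negP => /kmax /=; clear -ij; lia.
    move/gappedP: cg => /(_ k j ij); lia.
  have z'M i : (upd z k (z k).+1 i < M)%N.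
    by rewrite /upd; case: eqP => [_|_] //; apply: leq_ltn_trans (cM k).
  have := mu_step zg z'g z'M; rewrite uk => st.
  have z'c j : if up j then (upd z k (z k).+1 j <= c j)%N else (c j <= upd z k (z k).+1 j)%N.
    by have := zc j; rewrite /upd; case: eqP => [->|_] //; rewrite uk.
  have := IH _ z'g cg z'M cM z'c (updn _ _ _); rewrite /ndist => /(_ ltac:(lia)).
  apply: le_trans; rewrite exprSr -mulrA; apply: ler_wpM2l => //; exact: exprn_ge0.
have [/existsP[k0 k0P]|/existsPn nodn] := boolP [exists k, c k < z k]%N; last first.
  exfalso; have : (\sum_k ndist (z k) (c k))%N = 0%N.
    by apply/eqP; rewrite sum_nat_eq0; apply/forallP => k; rewrite /ndist; move: (noup k) (nodn k); lia.
  by rewrite sn.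
(* Only downward moves remain; move the first such coordinate, as the earlier ones are at their
   targets. *)
have [k zk kmin] := @arg_minnP _ k0 (fun k => c k < z k)%N (fun k => nat_of_ord k) k0P.
have uk : up k = false by have := zc k; case: (up k) => //; lia.
have zcle i : (c i <= z i)%N by move: (noup i); lia.
pose z' := upd z k (z k).-1.
have z'g : gapped z'.
  apply/gappedP => i j ij; rewrite /z' /upd; move/gappedP: (zg) => /(_ i j ij) g.
  case: (i =P k) => [ik|ik]; case: (j =P k) => [jk|jk]; subst => //; try lia.
  have : ~~ (c i < z i)%N by apply/negP => /kmin /=; clear -ij; lia.
  move/gappedP: cg => /(_ i k ij); lia.
have zE : upd z' k (z' k).+1 = z.
  apply: functional_extensionality => i; rewrite /z' /upd eqxx; case: eqP => [->|_] //; lia.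
have := @mu_step k z' z'g; rewrite zE uk => /(_ zg zM) st.
have z'M i : (z' i < M)%N by rewrite /z' /upd; case: eqP => // _; move: (zM k); lia.
have z'c j : if up j then (z' j <= c j)%N else (c j <= z' j)%N.
  by have := zc j; rewrite /z' /upd; case: eqP => [->|_] //; rewrite uk; lia.
have := IH _ z'g cg z'M cM z'c (updn _ _ _); rewrite /ndist => /(_ ltac:(lia)).
apply: le_trans; rewrite exprSr -mulrA; apply: ler_wpM2l => //; exact: exprn_ge0.
Qed.

Let in_orthant (x : 'I_d -> nat) (z : 'I_d -> nat) :=
  [forall k, if up k then z k < x k else x k <= z k]%N.

(** No cancellation: [mu] has one sign on gapped points, and the product of the factors has one sign
    on the orthant. *)
Lemma norm_integral x : `|integral x| =
  \sum_(z : {ffun 'I_d -> 'I_M} | gapped (fun i => z i) && in_orthant x (fun i => z i))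
      `|mu (fun i => z i)|.
Proof.
have [b hb] := mu_sign.
pose sg : R := (-1) ^+ b * \prod_k (if up k then 1 else -1).
have -> : integral x = sg *
  \sum_(z : {ffun 'I_d -> 'I_M} | gapped (fun i => z i) && in_orthant x (fun i => z i))
      `|mu (fun i => z i)|.
  rewrite mulr_sumr [RHS]big_mkcond; apply: eq_bigr => z _.
  have -> : \prod_k factor k (x k) z = (\prod_k (if up k then 1 else -1)) * (in_orthant x (fun i =>
      z i))%:R.
    have -> : (in_orthant x (fun i =>
        z i))%:R = \prod_k (if up k then z k < x k else x k <= z k)%N%:R :> R.
      case: (boolP (in_orthant x _)) => [/forallP h|]; first by rewrite big1 // => k _; rewrite h.
      by rewrite negb_forall => /existsP[k /negbTE hk]; rewrite (bigD1 k) //= hk mul0r.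
    rewrite -big_split; apply: eq_bigr => k _; rewrite /factor /=.
    by case: (up k); rewrite ?mul1r ?mulN1r.
  case: (boolP (gapped _)) => [zg|_] /=; last by rewrite !mul0r.
  rewrite {1}hb // mul1r /sg; case: in_orthant; rewrite ?mulr1 ?mulr0 //; ring.
have sg1 : `|sg| = 1.
  rewrite normrM normrX normrN1 expr1n mul1r normr_prod big1 // => k _.
  by case: (up k); rewrite ?normrN1 ?normr1.
by rewrite normrM sg1 mul1r ger0_norm // sumr_ge0.
Qed.

(** The point of the orthant nearest to [x]; for sparse [x], [|mu|] is largest there among the
    gapped points of the orthant. *)
Let corner (x : 'I_d -> nat) := fun k => if up k then (x k).-1 else x k.
(** Gap 3 keeps [corner x] gapped even if only the larger of two coordinates is decreased;
    positivity makes the predecessor genuine. *)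
Let sparse (x : 'I_d -> nat) :=
  (forall i j : 'I_d, i < j -> x i + 3 <= x j)%N /\ (forall i, 0 < x i < M)%N.

Lemma corner_gapped x : sparse x -> gapped (corner x).
Proof.
move=> [xg xM]; apply/gappedP => i j ij; rewrite /corner.
by case: (up i); case: (up j); move: (xg i j ij) (xM i) (xM j); lia.
Qed.

Lemma corner_lt x i : sparse x -> (corner x i < M)%N.
Proof. by move=> [_ xM]; rewrite /corner; case: (up i); move: (xM i); lia. Qed.

Lemma mu_corner_le_integral x : sparse x -> `|mu (corner x)| <= `|integral x|.
Proof.
move=> xs; rewrite norm_integral.
pose z0 : {ffun 'I_d -> 'I_M} := [ffun i => Ordinal (corner_lt i xs)].
have z0E : (fun i => z0 i : nat) = corner x.
  by apply: functional_extensionality => i; rewrite ffunE.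
rewrite (bigD1 z0) /=; last first.
  rewrite z0E corner_gapped //; apply/forallP => k; rewrite /corner.
  by case: (up k) => //; have [_ /(_ k)] := xs; lia.
by rewrite z0E lerDl sumr_ge0.
Qed.

(** By [mu_path], [|mu z|] is at most $2^{-n}$ times its value at the corner, $n$ being the
    $\ell_1$-distance. Without the gap condition the sum factors into [d] geometric series, each at
    most 2. *)
Lemma integral_le_mu_corner x : sparse x -> `|integral x| <= 2 ^+ d * `|mu (corner x)|.
Proof.
move=> xs; rewrite norm_integral.
pose w (k : 'I_d) (v : 'I_M) : R :=
  (if up k then v < x k else x k <= v)%N%:R * 2^-1 ^+ ndist v (corner x k).
apply: (@le_trans _ _ (\sum_(z : {ffun 'I_d -> 'I_M}) (\prod_k w k (z k)) * `|mu (corner x)|)).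
  rewrite big_mkcond; apply: ler_sum => z _; case: ifP => [/andP[zg /forallP zx]|_]; last first.
    by rewrite mulr_ge0 // prodr_ge0 // => k _; rewrite mulr_ge0 // exprn_ge0 // invr_ge0.
  have -> : \prod_k w k (z k) = 2^-1 ^+ (\sum_k ndist (z k) (corner x k))%N.
    by rewrite -prodrXr; apply: eq_bigr => k _; rewrite /w zx mul1r.
  have zc k : if up k then (z k <= corner x k)%N else (corner x k <= z k)%N.
    have := zx k; rewrite /corner; case: (up k) => //=; have [_ /(_ k)] := xs; lia.
  have := mu_path zg (corner_gapped xs) (fun i => ltn_ord (z i)) (fun i => corner_lt i xs) zc erefl.
  set n := (\sum_k _)%N => h.
  have p2 : 0 < 2 ^+ n :> R by rewrite exprn_gt0.
  rewrite exprVn ler_pdivlMl //; apply: le_trans h.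
  by apply: ler_wpM2r => //; apply: lerXn2r; rewrite ?nnegrE ?(le_trans _ lam2).
rewrite -mulr_suml; apply: ler_wpM2r => //.
rewrite -(bigA_distr_bigA w).
apply: (@le_trans _ _ (\prod_(k < d) 2)); last by rewrite prodr_const card_ord.
apply: ler_prod => k _; apply/andP; split.
  by apply: sumr_ge0 => v _; rewrite mulr_ge0 // exprn_ge0 // invr_ge0.
rewrite /w /corner; case: (up k).
  rewrite (eq_bigr (fun v : 'I_M => (v < x k)%N%:R * 2^-1 ^+ ((x k).-1 - v))); last first.
    by move=> v _; case: ltnP => h; rewrite ?mul0r // /ndist (_ : (v - (x k).-1 = 0)%N) ?add0n //; lia.
  apply: le_trans (sum_half_down _ _ _) _.
  have : (2^-1 : R) ^+ (x k - M) <= 1 by rewrite exprn_ile1 // ?invr_ge0 // invf_le1 // ler1n.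
  lra.
rewrite (eq_bigr (fun v : 'I_M => (x k <= v)%N%:R * 2^-1 ^+ (v - x k))); last first.
  by move=> v _; case: leqP => h; rewrite ?mul0r // /ndist (_ : (x k - v = 0)%N) ?addn0 //; lia.
apply: le_trans (sum_half_up _ _ _) _.
have : 0 <= (2^-1 : R) ^+ (M - x k) by rewrite exprn_ge0 // invr_ge0.
lra.
Qed.

Lemma mu_corner_step k x y : sparse x -> sparse y -> agree_off k x y -> (x k < y k)%N ->
  if up k then lam * `|mu (corner x)| <= `|mu (corner y)|
  else lam * `|mu (corner y)| <= `|mu (corner x)|.
Proof.
move=> xs ys xy xyk; have lam1 : 1 <= lam by apply: le_trans lam2; rewrite ler1n.
have cxy i : i != k -> corner x i = corner y i by move=> ik; rewrite /corner xy.
have sumE a b : (forall i, i != k -> a i = b i) -> (\sum_i ndist (a i) (b i))%N = ndist (a k) (b k).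
  move=> ab; rewrite (bigD1 k) //= big1 ?addn0 // => i ik; rewrite /ndist ab //; lia.
have le_lam n (r : R) : (0 < n)%N -> 0 <= r -> lam * r <= lam ^+ n * r.
  move=> n0 r0; apply: ler_wpM2r => //; by rewrite -{1}[lam]expr1 ler_weXn2l.
have xk0 : (0 < x k)%N by case: xs => _ /(_ k); lia.
case uk: (up k).
  have h i : if up i then (corner x i <= corner y i)%N else (corner y i <= corner x i)%N.
    case: (i =P k) => [->|/eqP ik]; last by rewrite cxy //; case: (up i).
    by rewrite uk /corner uk; lia.
  apply: le_trans (mu_path (corner_gapped xs) (corner_gapped ys) (fun i => corner_lt i xs)
      (fun i => corner_lt i ys) h (sumE _ _ cxy)).
  apply: le_lam => //; rewrite /ndist /corner uk; lia.
have cyx i : i != k -> corner y i = corner x i by move=> ik; rewrite cxy.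
have h i : if up i then (corner y i <= corner x i)%N else (corner x i <= corner y i)%N.
  case: (i =P k) => [->|/eqP ik]; last by rewrite cxy //; case: (up i).
  by rewrite uk /corner uk; lia.
apply: le_trans (mu_path (corner_gapped ys) (corner_gapped xs) (fun i => corner_lt i ys) (fun i =>
    corner_lt i xs) h (sumE _ _ cyx)).
apply: le_lam => //; rewrite /ndist /corner uk; lia.
Qed.

(** The integral lies within a factor $2^d$ of [mu] at the corner, so it inherits the growth of [mu]
    up to that factor. *)
Lemma lacunary_part : exists Ft : ('I_d -> nat) -> R,
  eq_mod_lower (fun x => increasing x /\ forall i, (x i <= M)%N) F Ft /\
  forall k x y, sparse x -> sparse y -> agree_off k x y -> (x k < y k)%N ->
    if up k then lam * `|Ft x| <= 2 ^+ d * `|Ft y| else lam * `|Ft y| <= 2 ^+ d * `|Ft x|.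
Proof.
exists integral; split; first exact: eq_mod_lower_integral.
have lam0 : 0 <= lam by apply: le_trans lam2.
have main x y : sparse x -> sparse y -> lam * `|mu (corner x)| <= `|mu (corner y)| ->
    lam * `|integral x| <= 2 ^+ d * `|integral y|.
  move=> xs ys h; apply: le_trans (ler_wpM2l lam0 (integral_le_mu_corner xs)) _.
  rewrite mulrCA; apply: ler_wpM2l; first exact: exprn_ge0.
  exact: le_trans h (mu_corner_le_integral ys).
move=> k x y xs ys xy xyk; have := mu_corner_step xs ys xy xyk.
by case: (up k); exact: main.
Qed.
End Integration.

(** * Signs and growth directions of mixed differences *)

(** Each new increment exceeds $1/l$ times the total so far, hence $(u_1-u_0)/l$; $l^2$ of them add
    up to at least $l(u_1-u_0)$, against the ratio bound for $0,1,l^2+1$. *)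
Lemma no_bounded_ratio (R : realFieldType) (u : nat -> R) (l : nat) : (0 < l)%N ->
  (forall p q, (p < q)%N -> (q <= l ^ 2 + 1)%N -> 0 <= u q - u p) ->
  (forall p q r, (p < q)%N -> (q < r)%N -> (r <= l ^ 2 + 1)%N ->
     `|u r - u q| < l%:R * `|u q - u p| /\ `|u q - u p| < l%:R * `|u r - u q|) -> False.
Proof.
move=> l0 mono ratio.
have grow t : (t <= l ^ 2)%N -> t%:R * (u 1%N - u 0%N) <= l%:R * (u t.+1 - u 1%N).
  elim: t => [|t IH] tl; first by rewrite mul0r subrr mulr0.
  have [] := ratio 0%N t.+1 t.+2 isT (ltnSn _) ltac:(lia).
  have m1 := mono t.+1 t.+2 (ltnSn _) ltac:(lia).
  have m2 := mono 0%N t.+1 isT ltac:(lia).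
  rewrite (ger0_norm m1) (ger0_norm m2) => _.
  have IH' := IH ltac:(lia).
  have m3 : 0 <= u t.+1 - u 1%N.
    by case: (t) tl => [|t'] tl; [rewrite subrr|apply: mono; lia].
  rewrite -natr1; move: (t%:R) (l%:R) IH' => t' l' IH' h; lra.
have l2 : (0 < l ^ 2)%N by rewrite expn_gt0 l0.
have [] := ratio 0%N 1%N (l ^ 2 + 1)%N isT ltac:(lia) (leqnn _).
have m1 := mono 1%N (l ^ 2 + 1)%N ltac:(lia) (leqnn _).
have m0 := mono 0%N 1%N isT ltac:(lia).
rewrite (ger0_norm m1) (ger0_norm m0) addn1 => h _.
have := grow _ (leqnn (l ^ 2)%N); rewrite natrX expr2 -mulrA.
by rewrite ler_pM2l ?ltr0n // leNgt h.
Qed.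

Lemma sorted_map_incr (u : seq nat) (b : nat -> nat) : sorted ltn u ->
  {in u &, forall w w', (w < w')%N -> (b w < b w')%N} -> sorted ltn (map b u).
Proof. by move=> us h; apply: (homo_sorted_in (P := [in u]) (e := ltn)) us => //; apply/allP. Qed.

(* A box with sides [lo i, hi i] is encoded by b (3 i) = lo i and b (3 i + 1) = hi i;
   b (3 k + 2) is an extra point beyond hi k. *)
Definition box_points d : seq nat := [seq w <- iota 0 (3 * d) | (w %% 3 < 2)%N].
Definition box_points3 d (k : 'I_d) : seq nat :=
  [seq w <- iota 0 (3 * d) | (w %% 3 < 2)%N || (w == 3 * k + 2)%N].

Arguments box_points : simpl never.
Arguments box_points3 : simpl never.

Lemma size_box_points d : size (box_points d) = (2 * d)%N.
Proof.
rewrite /box_points size_filter; elim: d => // d IH.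
have -> : (3 * d.+1 = 3 * d + 3)%N by clear; lia.
rewrite iotaD count_cat IH add0n /=.
have m t : ((3 * d + t) %% 3 = t %% 3)%N by rewrite mulnC modnMDl.
have := m 0%N; have := m 1%N; have := m 2%N; rewrite addn0 addn1 addn2 => -> -> -> /=.
clear; lia.
Qed.

Lemma size_box_points3 d (k : 'I_d) : (size (box_points3 k) <= 2 * d + 1)%N.
Proof.
rewrite -size_box_points /box_points3 /box_points !size_filter.
set a1 := fun w => (w %% 3 < 2)%N; set s := iota 0 _.
have c1 : (count_mem (3 * k + 2)%N s <= 1)%N by rewrite count_uniq_mem ?iota_uniq //; case: (_ \in _).
rewrite (eq_count (a2 := predU a1 (pred1 (3 * k + 2)%N))) //.
apply: leq_trans (leq_add (leqnn _) c1); rewrite -count_predUI; exact: leq_addr.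
Qed.

Section Directions.
Variables (R : realFieldType) (d : nat).
Implicit Types (F : ('I_d.+1 -> nat) -> R) (b : nat -> nat).

Definition box_lo b (i : 'I_d.+1) := b (3 * i)%N.
Definition box_hi b (i : 'I_d.+1) := b (3 * i + 1)%N.
Definition box_diff F b := mixed_diff F (box_lo b) (box_hi b).
Definition next_box_diff F (k : 'I_d.+1) b :=
  mixed_diff F (upd (box_lo b) k (b (3 * k + 1)%N)) (upd (box_hi b) k (b (3 * k + 2)%N)).

(** The tests to be made order invariant: the sign of a box, and growth or decay by [lam] from a box
    to its neighbour in direction [k]. *)
Definition box_test (lam : R) F (c : option ('I_d.+1 * bool)) b : bool :=
  match c with
  | None => 0 <= box_diff F b
  | Some (k, true) => lam * `|box_diff F b| <= `|next_box_diff F k b|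
  | Some (k, false) => lam * `|next_box_diff F k b| <= `|box_diff F b|
  end.

Definition box_test_points (c : option ('I_d.+1 * bool)) : seq nat :=
  if c is Some (k, _) then box_points3 k else box_points d.+1.

Lemma box_test_points_uniq c : uniq (box_test_points c).
Proof. by case: c => [[k e]|]; rewrite filter_uniq // iota_uniq. Qed.

Lemma size_box_test_points c : (size (box_test_points c) <= 2 * d + 3)%N.
Proof.
case: c => [[k e]|]; rewrite /box_test_points; last by rewrite size_box_points; clear; lia.
by apply: leq_trans (size_box_points3 k) _; clear; lia.
Qed.

Lemma mem_box_points3 (k : 'I_d.+1) w : (w \in box_points3 k) =
  ((w < 3 * d.+1) && ((w %% 3 < 2) || (w == 3 * k + 2)))%N.
Proof. by rewrite mem_filter mem_iota andbC. Qed.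

Lemma mem_box_points w : (w \in box_points d.+1) = ((w < 3 * d.+1) && (w %% 3 < 2))%N.
Proof. by rewrite mem_filter mem_iota andbC. Qed.

Lemma box_test_dep lam F c b b' : {in box_test_points c, b =1 b'} ->
  box_test lam F c b = box_test lam F c b'.
Proof.
move=> bb'.
have lo : box_lo b = box_lo b'.
  apply: functional_extensionality => i; apply: bb'; have := ltn_ord i.
  by case: c => [[k e]|] /=; rewrite ?mem_box_points3 ?mem_box_points; lia.
have hi : box_hi b = box_hi b'.
  apply: functional_extensionality => i; apply: bb'; have := ltn_ord i.
  by case: c => [[k e]|] /=; rewrite ?mem_box_points3 ?mem_box_points; lia.
case: c bb' => [[k e]|] bb' /=; last by rewrite /box_diff lo hi.
have k1 : b (3 * k + 1)%N = b' (3 * k + 1)%N.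
  by apply: bb'; rewrite /= mem_box_points3; have := ltn_ord k; lia.
have k2 : b (3 * k + 2)%N = b' (3 * k + 2)%N.
  by apply: bb'; rewrite /= mem_box_points3; have := ltn_ord k; lia.
by rewrite /next_box_diff /box_diff lo hi k1 k2.
Qed.

Lemma box_test_comp lam F c e b : box_test lam (fun x => F (e \o x)) c b = box_test lam F c (e \o b).
Proof.
have updE (x : 'I_d.+1 -> nat) k v : e \o upd x k v = upd (e \o x) k (e v).
  by apply: functional_extensionality => i; rewrite /upd /=; case: eqP.
by case: c => [[k []]|] /=; rewrite /next_box_diff /box_diff !mixed_diff_comp ?updE.
Qed.

Definition unit_box (z : 'I_d.+1 -> nat) w := (z (inord (w %/ 3)) + w %% 3)%N.

Lemma div3E i t : (t < 3)%N -> ((3 * i + t) %/ 3 = i)%N.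
Proof. by move=> t3; rewrite mulnC divnMDl // divn_small // addn0. Qed.

Lemma mod3E i t : (t < 3)%N -> ((3 * i + t) %% 3 = t)%N.
Proof. by move=> t3; rewrite mulnC modnMDl modn_small. Qed.

Lemma inord_div3 (i : 'I_d.+1) t : (t < 3)%N -> inord ((3 * i + t) %/ 3) = i.
Proof. by move=> t3; rewrite div3E // inord_val. Qed.

Lemma unit_boxE z (i : 'I_d.+1) t : (t < 3)%N -> unit_box z (3 * i + t) = (z i + t)%N.
Proof. by move=> t3; rewrite /unit_box inord_div3 // mod3E. Qed.

Lemma box_diff_unit F z : box_diff F (unit_box z) = mixed_diff F z (fun i => (z i).+1).
Proof.
congr mixed_diff; apply: functional_extensionality => i.
  by rewrite /box_lo -[(3 * i)%N]addn0 unit_boxE // addn0.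
by rewrite /box_hi unit_boxE // addn1.
Qed.

Lemma next_box_diff_unit F z k : let z' := upd z k (z k).+1 in
  next_box_diff F k (unit_box z) = mixed_diff F z' (fun i => (z' i).+1).
Proof.
rewrite /next_box_diff !unit_boxE //; congr mixed_diff; apply: functional_extensionality => i.
  by rewrite /upd; case: eqP => // _; rewrite ?addn1 // /box_lo -[(3 * i)%N]addn0 unit_boxE // addn0.
by rewrite /upd; case: eqP => // _; rewrite ?addn2 // /box_hi unit_boxE // addn1.
Qed.

Lemma increasing_on_box n u b : sorted ltn u -> {subset u <= gtn (3 * d.+1)%N} ->
  {in u &, forall w w', (w < w')%N -> (b w < b w')%N} -> {in u, forall w, (b w < n)%N} ->
  increasing_on n u b.
Proof.
move=> us u3 bi bn; split; first exact: sorted_map_incr.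
by apply/allP => _ /mapP[w wu ->]; exact: bn.
Qed.

Lemma box_index w : (w < 3 * d.+1)%N -> exists (i : 'I_d.+1) t, w = (3 * i + t)%N /\ (t < 3)%N.
Proof.
move=> h; have i : (w %/ 3 < d.+1)%N by lia.
by exists (Ordinal i), (w %% 3)%N => /=; split; lia.
Qed.

(** If neither growth nor decay held in direction [k], adjacent boxes would always have ratio below
    [l] both ways; the mixed difference, additive in its [k]-th side, would then contradict
    [no_bounded_ratio]. The bound [n.-1] leaves room for the upper endpoints of unit boxes. *)
Lemma directions F n l : (0 < l)%N -> (d.+1 * (l ^ 2 + 4) <= n)%N ->
  (forall c b b', increasing_on n (box_test_points c) b -> increasing_on n (box_test_points c) b' ->
     box_test l%:R F c b = box_test l%:R F c b') ->
  let mu z := mixed_diff F z (fun i => (z i).+1) in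
  (exists b : bool, forall z, gapped z -> (forall i, z i < n.-1)%N -> mu z = (-1) ^+ b * `|mu z|) /\
  exists up : 'I_d.+1 -> bool, forall k z, let z' := upd z k (z k).+1 in
    gapped z -> gapped z' -> (forall i, z' i < n.-1)%N ->
    if up k then l%:R * `|mu z| <= `|mu z'| else l%:R * `|mu z'| <= `|mu z|.
Proof.
move=> l0 nbig inv mu.
have upts c : sorted ltn (box_test_points c).
  by case: c => [[k e]|]; apply: sorted_filter (iota_ltn_sorted _ _); exact: ltn_trans.
have ult c : {subset box_test_points c <= gtn (3 * d.+1)%N}.
  by move=> w; case: c => [[k e]|] /=; rewrite ?mem_box_points3 ?mem_box_points => /andP[].
have P0 z : gapped z -> (forall i, z i < n.-1)%N -> increasing_on n (box_test_points None) (unit_box z).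
  move=> /gappedP zg zn; apply: increasing_on_box; [exact: upts|exact: ult| |].
    move=> w w'; rewrite !mem_box_points => /andP[/box_index[i [t [->
        t3]]] ht] /andP[/box_index[j [t' [-> t3']]] ht'].
    rewrite !unit_boxE // => ww'; case: (ltngtP i j) => [ij|ij|/val_inj ij];
        first by move: (zg i j ij); lia.
      by lia.
    by subst j; lia.
  move=> w; rewrite mem_box_points => /andP[/box_index[i [t [-> t3]]] ht]; rewrite unit_boxE //.
  by move: (zn i); lia.
have P1 k e z : gapped z -> gapped (upd z k (z k).+1) -> (forall i, upd z k (z k).+1 i < n.-1)%N ->
    increasing_on n (box_test_points (Some (k, e))) (unit_box z).
  move=> /gappedP zg /gappedP zg' zn; apply: increasing_on_box; [exact: upts|exact: ult| |].
    move=> w w'; rewrite !mem_box_points3 => /andP[/box_index[i [t [->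
        t3]]] ht] /andP[/box_index[j [t' [-> t3']]] ht'].
    rewrite !unit_boxE // => ww'; case: (ltngtP i j) => [ij|ij|/val_inj ij]; last by subst j; lia.
      case: (ltnP t 2) => t2; first by move: (zg i j ij); lia.
      have ik : i = k by apply: val_inj => /=; lia.
      subst i; move: (zg' k j ij); rewrite /upd eqxx; case: eqP => [jk|_]; last by lia.
      by subst j; rewrite ltnn in ij.
    by lia.
  move=> w; rewrite mem_box_points3 => /andP[/box_index[i [t [-> t3]]] ht]; rewrite unit_boxE //.
  move: (zn i); rewrite /upd; case: eqP => [->|ik]; first by lia.
  have : (i : nat) <> k by move=> h; apply: ik; exact: val_inj.
  by lia.
(* A reference point with spacing $l^2+4$: each direction has room for trial points up to
   [z0 k + l ^ 2 + 1], clear of the other sides. *)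
pose S := (l ^ 2 + 4)%N.
pose z0 (i : 'I_d.+1) := (i * S)%N.
have z0S (i j : 'I_d.+1) : (i < j)%N -> (z0 i + l ^ 2 + 4 <= z0 j)%N.
  by move=> ij; have : (i.+1 * S <= j * S)%N; [rewrite leq_mul2r ij orbT|rewrite mulSn addnC addnA].
have z0n i : (z0 i + l ^ 2 + 3 < n)%N.
  have : (i.+1 * S <= d.+1 * S)%N by rewrite leq_mul2r ltn_ord orbT.
  move/leq_trans/(_ nbig); rewrite mulSn /z0; move: (i * S)%N => a; rewrite /S.
  by move: (l ^ 2)%N => b; clear; lia.
clearbody z0; clear S nbig.
have l2 : (0 < l ^ 2)%N by rewrite expn_gt0 l0.
move: (l ^ 2)%N l2 (fun u => @no_bounded_ratio R u l l0) z0S z0n => lsq l2 no_ratio z0S z0n.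
have z0g : gapped z0 by apply/gappedP => i j /z0S; clear; lia.
have z0n' i : (z0 i < n.-1)%N by move: (z0n i); lia.
split.
  case ge0: (box_test l%:R F None (unit_box z0)).
    exists false => z zg zn; have := inv _ _ _ (P0 _ zg zn) (P0 _ z0g z0n').
    by rewrite ge0 /= box_diff_unit => h; rewrite expr0 mul1r ger0_norm.
  exists true => z zg zn; have := inv _ _ _ (P0 _ zg zn) (P0 _ z0g z0n');
      rewrite ge0 /= box_diff_unit => h.
  by rewrite expr1 mulN1r ltr0_norm ?opprK // ltNge /mu h.
have /fin_all_exists[up upP] : forall k : 'I_d.+1, exists e, forall b,
    increasing_on n (box_points3 k) b -> box_test l%:R F (Some (k, e)) b.
  move=> k.
  (* The unit box at [z0], except that direction [k] has its three points at distances [p], [q], [r]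
     from [z0 k]. *)
  pose tri p q r w := if (w %/ 3 == k)%N then (z0 k + nth 0%N [:: p; q;
      r] (w %% 3))%N else unit_box z0 w.
  have triE p q r t : (t < 3)%N -> tri p q r (3 * k + t)%N = (z0 k + nth 0%N [:: p; q; r] t)%N.
    by move=> t3; rewrite /tri div3E // eqxx mod3E.
  have triN p q r (i : 'I_d.+1) t : (t < 3)%N -> i != k -> tri p q r (3 * i + t)%N = (z0 i + t)%N.
    by move=> t3 ik; rewrite /tri div3E // val_eqE (negbTE ik) unit_boxE.
  have Ptri p q r : (p < q)%N -> (q < r)%N -> (r <= lsq + 1)%N ->
      increasing_on n (box_points3 k) (tri p q r).
    move=> pq qr rl.
    have val_tri (i : 'I_d.+1) t : (t < 3)%N -> exists v,
        [/\ tri p q r (3 * i + t)%N = (z0 i + v)%N, (v <= lsq + 1)%N &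
       v = if i == k then nth 0%N [:: p; q; r] t else t].
      move=> t3; case: (i =P k) => [->|/eqP ik].
        exists (nth 0%N [:: p; q; r] t); split=> //; first exact: triE.
        by case: t t3 => [|[|[|]]] //= _; lia.
      by exists t; split => //; [exact: triN | lia].
    apply: increasing_on_box; first exact: (upts (Some (k, true))).
    - exact: (ult (Some (k, true))).
    - move=> w w'; rewrite !mem_box_points3 => /andP[/box_index[i [t [->
        t3]]] ht] /andP[/box_index[j [t' [-> t3']]] ht'] ww'.
      have [v [-> vl vE]] := val_tri i t t3; have [v' [-> vl' vE']] := val_tri j t' t3'.
      case: (ltngtP i j) => [ij|ij|/val_inj ij]; last 1 first.
      + subst j; rewrite ltn_add2l vE vE'; case: eqP => _; last by lia.
        have : (t < t')%N by lia.
        by case: t t' t3 t3' {ht ht' ww' vE vE'} => [|[|[|]]] // [|[|[|]]] //=; lia.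
      + by move: (z0S i j ij) vl; clear; lia.
      + by lia.
    - move=> w; rewrite mem_box_points3 => /andP[/box_index[i [t [-> t3]]] ht].
      have [v [-> vl _]] := val_tri i t t3; move: (z0n i); lia.
  pose D p q := mixed_diff F (upd z0 k (z0 k + p)%N) (upd (fun i => (z0 i).+1) k (z0 k + q)%N).
  have D1 p q r : box_diff F (tri p q r) = D p q.
    congr mixed_diff; apply: functional_extensionality => i; rewrite /upd /box_lo /box_hi.
      rewrite -[(3 * i)%N]addn0; case: (i =P k) => [->|/eqP ik]; first by rewrite triE.
      by rewrite triN // addn0.
    by case: (i =P k) => [->|/eqP ik]; [rewrite triE|rewrite triN // addn1].
  have D2 p q r : next_box_diff F k (tri p q r) = D q r.
    rewrite /next_box_diff !triE //; congr mixed_diff; apply: functional_extensionality => i;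
        rewrite /upd /box_lo /box_hi.
      by case: (i =P k) => [//|/eqP ik]; rewrite -[(3 * i)%N]addn0 triN // addn0.
    by case: (i =P k) => [//|/eqP ik]; rewrite triN // addn1.
  have Dsplit p q r : D p r = D p q + D q r.
    rewrite /D (mixed_diff_split _ _ _ k (z0 k + q)%N); congr (_ + mixed_diff _ _ _).
    by apply: functional_extensionality => i; rewrite /upd; case: eqP.
  have Pb := Ptri 0%N 1%N 2%N isT isT ltac:(lia).
  case b1: (box_test l%:R F (Some (k, true)) (tri 0%N 1%N 2%N)).
    by exists true => b hb; rewrite (inv (Some (k, true)) b _ hb Pb).
  case b2: (box_test l%:R F (Some (k, false)) (tri 0%N 1%N 2%N)).
    by exists false => b hb; rewrite (inv (Some (k, false)) b _ hb Pb).
  exfalso.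
  have ratio p q r : (p < q)%N -> (q < r)%N -> (r <= lsq + 1)%N ->
     `|D q r| < l%:R * `|D p q| /\ `|D p q| < l%:R * `|D q r|.
    move=> pq qr rl; have hb := Ptri p q r pq qr rl.
    have := inv (Some (k, true)) _ _ hb Pb; have := inv (Some (k, false)) _ _ hb Pb.
    by rewrite b1 b2 /= D1 D2 => /negbT + /negbT; rewrite -!ltNge.
  have signD p q : (p < q)%N -> (q <= lsq + 1)%N -> (0 <= D p q) = (0 <= D 0%N 1%N).
    (* The sign test reads two points per direction, so the third may go one further; this admits
       $q=l^2+1$ with [q.+1] as third point. *)
    have P0t p' q' r' : (p' < q')%N -> (q' < r')%N -> (r' <= lsq + 2)%N ->
        increasing_on n (box_points d.+1) (tri p' q' r').
      move=> pq qr rl.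
      apply: increasing_on_box; first exact: (upts None).
      - exact: (ult None).
      - move=> w w'; rewrite !mem_box_points => /andP[/box_index[i [t [->
          t3]]] ht] /andP[/box_index[j [t' [-> t3']]] ht'] ww'.
        have bnd (i' : 'I_d.+1) t'' : (t'' < 2)%N ->
            (z0 i' <= tri p' q' r' (3 * i' + t'') <= z0 i' + lsq + 1)%N.
          move=> t2; case: (i' =P k) => [->|/eqP ik]; last by rewrite triN //; lia.
          by rewrite triE; [case: t'' t2 => [|[|]] //=; lia|lia].
        have tt : (t < 2)%N by lia.
        have tt' : (t' < 2)%N by lia.
        case: (ltngtP i j) => [ij|ij|/val_inj ij].
        + by move: (bnd i t tt) (bnd j t' tt') (z0S i j ij); clear; lia.
        + by lia.
        + subst j; have [-> ->] : t = 0%N /\ t' = 1%N by lia.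
          by case: (i =P k) => [->|/eqP ik]; [rewrite !triE //=; lia|rewrite !triN //; lia].
      - move=> w; rewrite mem_box_points => /andP[/box_index[i [t [-> t3]]] ht]; move: (z0n i).
        case: (i =P k) => [->|/eqP ik]; last by rewrite triN //; lia.
        by rewrite triE //; case: t t3 ht => [|[|[|]]] //=; lia.
    move=> pq ql.
    by have /= := inv None _ _ (P0t p q q.+1 pq (ltnSn _) ltac:(lia))
        (P0t 0%N 1%N 2%N isT isT ltac:(lia)); rewrite !D1.
  (* The increments of $q\mapsto D(0,q)$ are the $D(p,q)$, all of one sign; if they are negative,
     $-D$ is used. *)
  have uD p q : D 0%N q - D 0%N p = D p q by rewrite (Dsplit 0%N p q) addrC addKr.
  case s: (0 <= D 0%N 1%N).
    apply: (no_ratio (D 0%N)) => [p q pq ql|p q r pq qr rl].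
      by rewrite uD signD.
    by rewrite !uD; apply: ratio.
  apply: (no_ratio (fun t => - D 0%N t)) => [p q pq ql|p q r pq qr rl].
    rewrite -opprD uD oppr_ge0; apply: ltW; rewrite ltNge signD // s //.
  by rewrite -!opprD !normrN !uD; apply: ratio.
exists up => k z z' zg zg' zn; have := upP k _ (P1 k true z zg zg' zn).
by rewrite /= box_diff_unit next_box_diff_unit; case: (up k).
Qed.
End Directions.

(** * Descent on the number of variables *)

(** The other terms together are at most $(|T|-1)/|T|$ of the dominant one; if that one is 0, they
    all vanish. *)
Lemma dominant_sign (R : realFieldType) (T : finType) (P : pred T) (x : T -> R) i0 : P i0 ->
  (forall i, P i -> i != i0 -> #|T|%:R * `|x i| <= `|x i0|) ->
  (\sum_(i | P i) x i <= 0) = (x i0 <= 0).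
Proof.
move=> Pi0 dom; rewrite (bigD1 i0) //=; set S := \sum_(i | _) _.
have T0 : (0 < #|T|)%N by apply/card_gt0P; exists i0.
have SN : #|T|%:R * `|S| <= (#|T|.-1)%:R * `|x i0|.
  apply: (@le_trans _ _ (\sum_(i | P i && (i != i0)) #|T|%:R * `|x i|)).
    by rewrite -mulr_sumr ler_wpM2l // ler_norm_sum.
  apply: (@le_trans _ _ (\sum_(i | P i && (i != i0)) `|x i0|)).
    by apply: ler_sum => i /andP[]; exact: dom.
  rewrite sumr_const mulr_natl; apply: ler_wpMn2l => //.
  apply: (@leq_trans #|[pred i | i != i0]|).
    by apply: subset_leq_card; apply/subsetP => i; rewrite !inE => /andP[].
  by rewrite (cardC1 i0).
have N0 : 0 < #|T|%:R :> R by rewrite ltr0n.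
have NE : #|T|%:R = (#|T|.-1)%:R + 1 :> R by rewrite natr1 prednK.
move: SN N0; rewrite NE; have : 0 <= (#|T|.-1)%:R :> R by [].
move: (#|T|.-1)%:R => N N1 SN N0.
have S1 : (N + 1) * S <= N * `|x i0| by apply: le_trans SN; rewrite ler_pM2l // ler_norm.
have S2 : - (N * `|x i0|) <= (N + 1) * S.
  by rewrite lerNl -mulrN; apply: le_trans SN; rewrite ler_pM2l // -normrN ler_norm.
case: (ltrgtP (x i0) 0) => x0.
- rewrite ltr0_norm // in S1; apply/idP; rewrite -(pmulr_rle0 _ N0); nra.
- rewrite gtr0_norm // in S2; apply/negbTE; rewrite -ltNge -(pmulr_rgt0 _ N0); nra.
- move: S1 S2; rewrite x0 normr0 mulr0 oppr0 add0r => S1 _; by rewrite -(pmulr_rle0 _ N0).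
Qed.

Section IncreasingMaps.
Variable r : nat.

Definition image_set d (s : {ffun 'I_d -> 'I_r}) : {set 'I_r} := [set s i | i : 'I_d].

Lemma incrbP d (s : {ffun 'I_d -> 'I_r}) :
  reflect (forall i j : 'I_d, (i < j)%N -> (s i < s j)%N) (incrb s).
Proof.
apply: (iffP forallP) => [h i j|h i]; first by move/forallP: (h i) => /(_ j)/implyP.
by apply/forallP => j; apply/implyP; apply: h.
Qed.

Lemma incrb_inj d (s : {ffun 'I_d -> 'I_r}) : incrb s -> injective s.
Proof.
move=> /incrbP si i j sij; apply: val_inj => /=; case: (ltngtP i j) => // /si; by rewrite sij ltnn.
Qed.

Lemma card_image_set d (s : {ffun 'I_d -> 'I_r}) : incrb s -> #|image_set s| = d.
Proof. by move=> si; rewrite card_imset ?card_ord //; exact: incrb_inj. Qed.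

Lemma sorted_map_val_ord d (e : 'I_d -> nat) : increasing e -> sorted ltn (map e (enum 'I_d)).
Proof.
move=> ei; have := iota_ltn_sorted 0 d; rewrite -val_enum_ord sorted_map.
rewrite !sorted_map; apply: sub_sorted => i j; exact: ei.
Qed.

Lemma image_set_inj d (s s' : {ffun 'I_d -> 'I_r}) : incrb s -> incrb s' ->
    image_set s = image_set s' -> s = s'.
Proof.
move=> /incrbP si /incrbP si' im.
have E : map (fun i => s i : nat) (enum 'I_d) = map (fun i => s' i : nat) (enum 'I_d).
  apply: (irr_sorted_eq ltn_trans ltnn); try exact: sorted_map_val_ord.
  move=> w; apply/mapP/mapP => -[i _ ->].
    have : s i \in image_set s' by rewrite -im imset_f.
    by case/imsetP => j _ ->; exists j; rewrite ?mem_enum.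
  have : s' i \in image_set s by rewrite im imset_f.
  by case/imsetP => j _ ->; exists j; rewrite ?mem_enum.
apply/ffunP => i; apply: val_inj => /=.
by move/eq_in_map: E => /(_ i); rewrite mem_enum; exact.
Qed.

Lemma incrb_lift d (s : {ffun 'I_d.+1 -> 'I_r}) k : incrb s -> incrb [ffun i => s (lift k i)].
Proof.
move=> /incrbP si; apply/incrbP => i j ij; rewrite !ffunE; apply: si.
by rewrite /= ltnNge leq_bump2 -ltnNge.
Qed.
End IncreasingMaps.

Section Levels.
Variables (R : realFieldType) (r D : nat) (J : finType).

Definition bounded_increasing n (a : 'I_r -> nat) := increasing a /\ forall i, (a i < n)%N.

Definition supported (L : {set 'I_r}) (G : ('I_r -> nat) -> R) :=
  forall a b, {in L, a =1 b} -> G a = G b.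

Definition lacunary (lam : R) n (L : {set 'I_r}) (G : ('I_r -> nat) -> R) :=
  forall k, k \in L -> exists up : bool, forall a b,
    bounded_increasing n a -> bounded_increasing n b -> agree_off k a b -> (a k < b k)%N ->
    if up then lam * `|G a| <= `|G b| else lam * `|G b| <= `|G a|.

Definition sign_homogeneous n (g : J -> ('I_r -> nat) -> R) := forall j a b,
  bounded_increasing n a -> bounded_increasing n b -> (g j a <= 0) = (g j b <= 0).

Lemma bounded_increasing_comp n M e a : embeds n M e -> bounded_increasing n a ->
    bounded_increasing M (e \o a).
Proof.
move=> [ei eM] [ai an]; split=> [i j ij|i] /=; last exact: eM.
by apply: ei => //; exact: ai.
Qed.

Lemma lacunary_comp lam n M e L G : embeds n M e -> lacunary lam M L G ->
    lacunary lam n L (fun a => G (e \o a)).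
Proof.
move=> eM lac k kL; have [up h] := lac k kL; exists up => a b ha hb ab abk.
apply: h; try exact: (bounded_increasing_comp eM).
  by move=> i ik /=; rewrite ab.
by case: eM => ei _; apply: ei => //; case: hb.
Qed.

(** [lam0] counts the index sets, so a term exceeding the others by this factor decides the sign of
    a sum over [L]; the square is what excludes ties. *)
Let lam0 := #|{set 'I_r}|.
Let lam := (lam0 ^ 2)%N.

Lemma lam0_gt1 : (0 < r)%N -> (1 < lam0)%N.
Proof.
by move=> r0; rewrite /lam0 -cardsT -powersetT card_powerset cardsT card_ord -[X in (X < _)%N](expn0 2) ltn_exp2l.
Qed.

Definition pair_points (L L' : {set 'I_r}) : seq nat := [seq val i | i <- enum (L :|: L')].

Lemma sorted_pair_points L L' : sorted ltn (pair_points L L').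
Proof.
rewrite /pair_points sorted_map {1}/enum_mem; apply: sorted_filter; first by move=> a b c /=;
    exact: ltn_trans.
by have := iota_ltn_sorted 0 r; rewrite -val_enum_ord sorted_map enumT.
Qed.

Lemma mem_pair_points L L' (i : 'I_r) : (val i \in pair_points L L') = (i \in L) || (i \in L').
Proof. by rewrite mem_map ?mem_enum ?inE //; exact: val_inj. Qed.

Definition as_nat_fun (a : 'I_r -> nat) (w : nat) : nat := oapp a 0%N (insub w).

Lemma as_nat_funE a (i : 'I_r) : as_nat_fun a (val i) = a i.
Proof. by rewrite /as_nat_fun valK. Qed.

Lemma increasing_on_as_nat_fun n a (u : seq 'I_r) : bounded_increasing n a -> sorted ltn (map val u) ->
  increasing_on n (map val u) (as_nat_fun a).
Proof.
move=> [ai an] us; split; last first.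
  by rewrite -map_comp; apply/allP => _ /mapP[i _ ->] /=; rewrite as_nat_funE an.
apply: sorted_map_incr => // _ _ /mapP[i _ ->] /mapP[j _ ->] ij; rewrite !as_nat_funE; exact: ai.
Qed.

(** The tests are the sign of one term and the comparison of two by the factor [lam0]; they read the
    coordinates in $L\cup L'$, at most $2D$ points. *)
Lemma ramsey_lacunary_family : (0 < D)%N -> (0 < r)%N -> exists C, (0 < C)%N /\ forall n, (0 < n)%N ->
  forall M, (twn (2 * D) (C * n) <= M)%N -> forall G : J -> {set 'I_r} -> ('I_r -> nat) -> R,
  (forall j L, supported L (G j L)) -> (forall j L, lacunary lam%:R M L (G j L)) ->
  exists e, embeds n M e /\
    sign_homogeneous n (fun j a => \sum_(L : {set 'I_r} | (#|L| <= D)%N) G j L (e \o a)).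
Proof.
move=> D0 r0.
pose small (L L' : {set 'I_r}) := ((#|L| <= D) && (#|L'| <= D))%N.
pose u (c : J * {set 'I_r} * {set 'I_r} * bool) : seq nat :=
  if small c.1.1.2 c.1.2 then pair_points c.1.1.2 c.1.2 else [::].
have D2 : (0 < 2 * D)%N by rewrite muln_gt0.
have [||C [C0 HC]] := @ramsey_order_invariant (2 * D) _ u D2.
- move=> c; rewrite /u; case: ifP => // _; exact: sorted_uniq ltn_trans ltnn _ (sorted_pair_points _ _).
- move=> c; rewrite /u; case: ifP => // /andP[c1 c2]; rewrite size_map -cardE.
  apply: leq_trans (leq_card_setU _ _) _; rewrite mul2n -addnn; exact: leq_add.
exists (C * (2 * r + 1))%N; split; first by rewrite muln_gt0 C0 addn1.
move=> n n0 M nM G sup lac.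
pose P (c : J * {set 'I_r} * {set 'I_r} * bool) (b : nat -> nat) : bool :=
  let: (j, L, L', t) := c in small L L' &&
   (if t then lam0%:R * `|G j L (fun i => b i)| <= `|G j L' (fun i => b i)| else G j L (fun i =>
       b i) <= 0).
have [|||e [eM eP]] := HC (n + 2 * r)%N _ M _ P.
- by rewrite addn_gt0 n0.
- apply: leq_trans nM; apply: twn_mono; rewrite -mulnA leq_mul2l; apply/orP; right; clear -n0; nia.
- move=> [[[j L] L'] t] b b'; rewrite /u /P /=; case: ifP => //= _ bb'.
  rewrite (sup j L _ (fun i => b' i)) ?(sup j L' _ (fun i => b' i)) // => i iL.
    by apply: bb'; rewrite mem_pair_points iL ?orbT.
  by apply: bb'; rewrite mem_pair_points iL ?orbT.
pose test j L L' t a := P (j, L, L', t) (e \o as_nat_fun a).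
have funE a : (fun i : 'I_r => (e \o as_nat_fun a) i) = e \o a.
  by apply: functional_extensionality => i /=; rewrite as_nat_funE.
have inv j L L' t a b : bounded_increasing (n + 2 * r) a -> bounded_increasing (n + 2 * r) b ->
    test j L L' t a = test j L L' t b.
  move=> ha hb; apply: eP; rewrite /u /=; case: ifP => // _;
    by apply: increasing_on_as_nat_fun => //; exact: sorted_pair_points.
exists e; split.
  by case: eM => ei em; split=> [x y xy yn|x xn]; [apply: ei|apply: em]; lia.
move=> j.
(* Even values leave room to move one coordinate by 1; the additional [2 * r] values make this
   possible even for small [n]. *)
pose a0 (i : 'I_r) := (2 * i)%N.
have a0b : bounded_increasing (n + 2 * r) a0.
  by split=> [i k ik|i]; rewrite /a0; [lia|have := ltn_ord i; lia].
pose a1 k := upd a0 k (2 * k + 1)%N.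
have a1b k : bounded_increasing (n + 2 * r) (a1 k).
  split=> [i l il|i]; rewrite /a1 /upd /a0; last by case: eqP => _; have := ltn_ord i; have :=
      ltn_ord k; lia.
  by case: (i =P k) => [?|_]; case: (l =P k) => [?|_]; subst; lia.
have lam01 := lam0_gt1 r0.
have lac0 (L : {set 'I_r}) k : k \in L ->
    (lam%:R * `|G j L (e \o a0)| <= `|G j L (e \o a1 k)|) \/
        (lam%:R * `|G j L (e \o a1 k)| <= `|G j L (e \o a0)|).
  move=> kL; have [up /(_ a0 (a1 k))] := lacunary_comp eM (lac j L) kL.
  case: up => h; [left|right]; apply: h => //; try (by move=> i ik; rewrite /a1 /upd (negbTE ik));
    by rewrite /a1 /upd /a0 eqxx addn1.
have testE L L' a : test j L L' true a = small L L' && (lam0%:R * `|G j L (e \o a)| <= `|G j L' (e \o a)|).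
  by rewrite /test /P funE.
have testE' L L' a : test j L L' false a = small L L' && (G j L (e \o a) <= 0).
  by rewrite /test /P funE.
(* If neither of |G_L|, |G_L'| dominates the other, then both stay comparable while a coordinate
   outside L' moves; only G_L sees the move, contradicting its lacunarity. *)
have no_tie (L L' : {set 'I_r}) k : small L L' -> k \in L -> k \notin L' ->
    ~~ test j L L' true a0 -> ~~ test j L' L true a0 -> False.
  move=> sm kL kL' t1 t2.
  have sm' : small L' L by rewrite /small andbC.
  have G' : G j L' (e \o a1 k) = G j L' (e \o a0).
    by apply: sup => i iL' /=; rewrite /a1 /upd; case: eqP => [ik|//]; rewrite -ik iL' in kL'.
  have := t1; rewrite (inv _ _ _ _ _ _ a0b (a1b k)) testE sm /= -ltNge G' => t1'.
  have := t2; rewrite (inv _ _ _ _ _ _ a0b (a1b k)) testE sm' /= -ltNge G' => t2'.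
  move: t1 t2; rewrite !testE sm sm' /= -!ltNge => t1 t2.
  have l0 : 0 < lam0%:R :> R by rewrite ltr0n; apply: ltn_trans lam01.
  have := lac0 L k kL; rewrite /lam natrX expr2.
  move: (lam0%:R) l0 t1 t2 t1' t2' => l l0 t1 t2 t1' t2'.
  have e1 : l * `|G j L' (e \o a0)| < l * l * `|G j L (e \o a0)| by rewrite -mulrA ltr_pM2l.
  have e2 : l * `|G j L' (e \o a0)| < l * l * `|G j L (e \o a1 k)| by rewrite -mulrA ltr_pM2l.
  by case => h; lra.
have total L L' : small L L' -> L != L' -> test j L L' true a0 \/ test j L' L true a0.
  move=> sm LL'; case t1: (test j L L' true a0); first by left.
  case t2: (test j L' L true a0); first by right.
  exfalso; have sm' : small L' L by rewrite /small andbC.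
  have : ~~ (L \subset L') || ~~ (L' \subset L) by rewrite -negb_and -eqEsubset.
  case/orP => /subsetPn[k kL kL'].
    by apply: (@no_tie L L' k) => //; rewrite ?t1 ?t2.
  by apply: (@no_tie L' L k) => //; rewrite ?t1 ?t2.
have P0 : (#|@set0 'I_r| <= D)%N by rewrite cards0.
have [Lm smL Lmax] := @arg_maxP _ _ _ _ (fun L : {set 'I_r} => #|L| <= D)%N (fun L =>
    `|G j L (e \o a0)|) P0.
have dom (L : {set 'I_r}) : (#|L| <= D)%N -> L != Lm -> test j L Lm true a0.
  move=> sL LLm; have sm : small L Lm by rewrite /small sL.
  (* If instead the maximal term were dominated, [lam0] times it would be at most itself; then both
     terms vanish and the comparison holds trivially. *)
  have [//|] := total L Lm sm LLm.
  have sm' : small Lm L by rewrite /small andbC.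
  rewrite !testE sm sm' /= => h; have /= h' := Lmax L sL.
  have l1 : 1 < lam0%:R :> R by rewrite ltr1n.
  move: (lam0%:R) h l1 h' => l h l1 h'.
  have z : `|G j Lm (e \o a0)| = 0.
    by apply/eqP; rewrite eq_le normr_ge0 andbT; have := normr_ge0 (G j Lm (e \o a0)); nra.
  by have := normr_ge0 (G j L (e \o a0)); rewrite z in h' *; nra.
have sgn a : bounded_increasing n a ->
    (\sum_(L : {set 'I_r} | (#|L| <= D)%N) G j L (e \o a) <= 0) = test j Lm Lm false a0.
  move=> [ai an]; have ab : bounded_increasing (n + 2 * r) a.
    by split=> // i; apply: leq_trans (an i) (leq_addr _ _).
  rewrite (@dominant_sign _ _ (fun L : {set 'I_r} => #|L| <= D)%N (fun L => G j L (e \o a)) Lm) //.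
    by rewrite -(inv _ _ _ _ _ _ ab a0b) testE' /small smL.
  move=> L sL LLm; have := dom L sL LLm.
  by rewrite (inv _ _ _ _ _ _ a0b ab) testE /small sL smL.
by move=> a b /sgn -> /sgn ->.
Qed.

(** The state of the descent: terms in more than [d] variables are already lacunary, the rest are
    arbitrary functions of [d] variables. At [d = D] this is $D$-dependence. *)
Definition level_sum d M (Psi : J -> {ffun 'I_d -> 'I_r} -> ('I_d -> nat) -> R)
    (G : J -> {set 'I_r} -> ('I_r -> nat) -> R) (g : J -> ('I_r -> nat) -> R) :=
  [/\ forall j L, supported L (G j L), forall j L, lacunary lam%:R M L (G j L) &
    forall j a, bounded_increasing M a -> g j a =
      \sum_(s : {ffun 'I_d -> 'I_r} | incrb s) Psi j s (fun i => a (s i)) +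
      \sum_(L : {set 'I_r} | (d < #|L| <= D)%N) G j L a].

Definition ramsey_level d h := exists C, (0 < C)%N /\ forall n, (0 < n)%N ->
  forall M, (twn h (C * n) <= M)%N -> forall Psi G g, @level_sum d M Psi G g ->
  exists e, embeds n M e /\ sign_homogeneous n (fun j a => g j (e \o a)).

(** A function of no variables is a constant; it becomes the term of [set0], which is lacunary
    vacuously. *)
Lemma ramsey_level0 : (0 < D)%N -> (0 < r)%N -> ramsey_level 0 (2 * D).
Proof.
move=> D0 r0; have [C [C0 HC]] := ramsey_lacunary_family D0 r0.
exists C; split=> // n n0 M nM Psi G g [sup lac gE].
pose s0 : {ffun 'I_0 -> 'I_r} := ffun0 (card_ord 0).
pose G' j (L : {set 'I_r}) := if L == set0 then fun a => Psi j s0 (fun i => a (s0 i)) else G j L.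
have [||e [eM eh]] := HC n n0 M nM G'.
- move=> j L a b ab; rewrite /G'; case: eqP => _; last exact: sup.
  by congr Psi; apply: functional_extensionality => -[].
- move=> j L k kL; rewrite /G'; case: eqP => [L0|_]; last exact: lac.
  by rewrite L0 inE in kL.
exists e; split=> // j a b ha hb.
have gG c : bounded_increasing n c ->
    g j (e \o c) = \sum_(L : {set 'I_r} | (#|L| <= D)%N) G' j L (e \o c).
  move=> hc; rewrite gE; last exact: bounded_increasing_comp eM hc.
  rewrite [RHS](bigD1 set0) ?cards0 //=; congr (_ + _).
    rewrite (big_pred1 s0) ?/G' ?eqxx // => s /=.
    have -> : s = s0 by apply/ffunP => -[].
    by rewrite eqxx; apply/incrbP => -[].
  apply: eq_big => L; first by rewrite card_gt0 andbC.
  by rewrite card_gt0 /G' => /andP[/negbTE ->].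
by rewrite !gG //; exact: eh.
Qed.

Lemma sum_incrb_image d (Phi : {ffun 'I_d -> 'I_r} -> R) :
  \sum_(s | incrb s) Phi s = \sum_(L : {set 'I_r} | #|L| == d)
    (if [pick s : {ffun 'I_d -> 'I_r} | incrb s && (image_set s == L)] is Some s then Phi s else 0).
Proof.
rewrite (partition_big (@image_set r d) (fun L => #|L| == d)) /=; last first.
  by move=> s /card_image_set ->.
apply: eq_bigr => L _; case: pickP => [s /andP[si /eqP sL]|no]; last by rewrite big_pred0.
rewrite (big_pred1 s) // => s' /=; apply/andP/eqP => [[si' /eqP sL']|->]; last by rewrite sL.
by apply: image_set_inj; rewrite ?sL.
Qed.

(** The value 0 at [k] is arbitrary: the result is fed to functions that ignore coordinate [k]. *)
Let insert d (k : 'I_d.+1) (y : 'I_d -> nat) (i : 'I_d.+1) : nat := oapp y 0%N (unlift k i).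

(** Turns increasing tuples into positive ones with gaps at least 3, as sparseness demands. *)
Definition spread (t : nat) := (3 * t + 1)%N.

(** [l] exceeds [lam] by the factor $2^{d+1}$ that [lacunary_part] loses. *)
Lemma decompose_level d M2 n1 l (F : ('I_d.+1 -> nat) -> R) :
  (2 <= l)%N -> (l = 2 ^ d.+1 * lam)%N -> (d.+1 * (l ^ 2 + 4) <= n1)%N -> (3 * M2 + 2 <= n1)%N ->
  (forall c b b', increasing_on n1 (box_test_points c) b -> increasing_on n1 (box_test_points c) b' ->
     box_test l%:R F c b = box_test l%:R F c b') ->
  exists Ft H up, 
   [/\ forall (k : 'I_d.+1) x y, agree_off k x y -> H k x = H k y,
       forall x, increasing x -> (forall i, x i < n1)%N -> F x = Ft x + \sum_(k < d.+1) H k x &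
       forall (k : 'I_d.+1) x y, increasing x -> increasing y -> (forall i, x i < M2)%N ->
           (forall i, y i < M2)%N ->
          agree_off k x y -> (x k < y k)%N ->
          if up k then lam%:R * `|Ft (spread \o x)| <= `|Ft (spread \o y)|
          else lam%:R * `|Ft (spread \o y)| <= `|Ft (spread \o x)| :> R].
Proof.
move=> l2 lE nl nM hinv.
have l0 : (0 < l)%N by apply: leq_trans l2.
have [sgn [up stp]] := @directions R d F n1 l l0 nl hinv.
have l2R : 2 <= l%:R :> R by rewrite ler_nat.
have [Ft [[H [Hk HE]] FtL]] := lacunary_part l2R sgn stp.
have n10 : (0 < n1)%N by clear -nM; lia.
exists Ft, H, up; split=> //.
  by move=> x xi xn; apply: HE; split=> // i; rewrite -ltnS prednK.
move=> k x y xi yi xM yM xy xyk.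
have sparse1 z : increasing z -> (forall i, z i < M2)%N ->
    (forall i j : 'I_d.+1, i < j ->
        (spread \o z) i + 3 <= (spread \o z) j)%N /\ (forall i, 0 < (spread \o z) i < n1.-1)%N.
  move=> zi zM; split=> [i j ij|i] /=; rewrite /spread.
    by move: (zi i j ij); clear; lia.
  by move: (zM i) nM; clear; lia.
have e1xy : agree_off k (spread \o x) (spread \o y) by move=> i ik /=; rewrite xy.
have e1lt : ((spread \o x) k < (spread \o y) k)%N by move: xyk; rewrite /= /spread; clear; lia.
have p2 : 0 < 2 ^+ d.+1 :> R by rewrite exprn_gt0.
have := FtL k _ _ (sparse1 _ xi xM) (sparse1 _ yi yM) e1xy e1lt.
by rewrite lE natrM natrX; case: (up k); rewrite -mulrA ler_pM2l.
Qed.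

(** Ramsey's theorem for $(2d+3)$-tuples nests a tower of height $2d+3$ around one of height [h];
    they share a level, so the cost is $2d+2$. *)
Lemma ramsey_levelS d h : (0 < r)%N -> (0 < h)%N -> (d < D)%N -> ramsey_level d h ->
  ramsey_level d.+1 (h + (2 * d + 2)).
Proof.
move=> r0 h0 dD [C [C0 HC]].
pose T := {ffun 'I_d.+1 -> 'I_r}.
pose u (c : J * T * option ('I_d.+1 * bool)) := box_test_points c.2.
have d3 : (0 < 2 * d + 3)%N by rewrite addn3.
have [||C1 [C10 HC1]] := @ramsey_order_invariant (2 * d + 3) _ u d3.
- by move=> c; exact: box_test_points_uniq.
- by move=> c; exact: size_box_test_points.
have lam0l := lam0_gt1 r0.
have [l lE] : exists l, l = (2 ^ d.+1 * lam)%N by exists (2 ^ d.+1 * lam)%N.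
have l2 : (2 <= l)%N.
  have : (0 < 2 ^ d)%N by rewrite expn_gt0.
  by rewrite lE expnS /lam; move: (2 ^ d)%N lam0 lam0l; clear; nia.
(* Makes [n1 = K * M2] large enough both for [directions] and for the spread points below
   [3 * M2]. *)
pose K := (6 + d.+1 * (l ^ 2 + 4))%N.
exists (C1 * K * C)%N; split; first by rewrite !muln_gt0 C10 C0.
move=> n n0 M nM Psi G g [sup lac gE].
have [M2 M2E] : exists M2, M2 = twn h (C * n) by exists (twn h (C * n)).
have M20 : (0 < M2)%N by rewrite M2E; apply: leq_trans (twn_ge _ _); rewrite muln_gt0 C0.
have [n1 n1E] : exists n1, n1 = (K * M2)%N by exists (K * M2)%N.
have n10 : (0 < n1)%N by rewrite n1E muln_gt0 M20.
pose P (c : J * T * option ('I_d.+1 * bool)) b := box_test l%:R (Psi c.1.1 c.1.2) c.2 b.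
have [||e0 [e0M e0P]] := HC1 n1 n10 M _ P.
- apply: leq_trans nM; rewrite n1E M2E mulnA.
  apply: (@leq_trans (twn (2 * d + 3) (twn h (C1 * K * (C * n))))).
    by apply: twn_mono; apply: mul_twn; rewrite ?muln_gt0 ?C10 ?C0.
  rewrite twn_comp // mulnA; apply: twn_monok; first by move: h0; clear; lia.
  by clear; lia.
- by move=> c b b' bb'; exact: box_test_dep.
pose F (p : J * T) x := Psi p.1 p.2 (e0 \o x).
have nl : (d.+1 * (l ^ 2 + 4) <= n1)%N.
  by rewrite n1E; apply: leq_trans (leq_pmulr _ M20); exact: leq_addl.
have nM2 : (3 * M2 + 2 <= n1)%N.
  rewrite n1E /K mulnDl; apply: leq_trans (leq_addr _ _); by move: M20; clear; lia.
have hinv p c b b' : increasing_on n1 (box_test_points c) b ->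
    increasing_on n1 (box_test_points c) b' ->
    box_test l%:R (F p) c b = box_test l%:R (F p) c b'.
  by move=> hb hb'; rewrite /F !box_test_comp; exact: (e0P (p, c)).
have /fin_all_exists[Ft /fin_all_exists[H /fin_all_exists[up HFt]]] :=
  fun p => decompose_level l2 lE nl nM2 (hinv p).
have sM : embeds M2 n1 spread.
  split=> [x y xy _|x xM]; rewrite /spread; first by move: xy; clear; lia.
  by move: xM nM2; clear; lia.
pose e := e0 \o spread.
have eM : embeds M2 M e.
  case: sM e0M => [s1 s2] [e1 e2]; split=> [x y xy yM|x xM] /=; last by apply: e2; exact: s2.
  by apply: e1; [exact: s1|exact: s2].
(* [drop] deletes the [k]-th index of [s]; [Psi'] gathers at [s'] all remainders [H] whose remaining
   indices are [s']. *)
pose drop (p : T * 'I_d.+1) : {ffun 'I_d -> 'I_r} := [ffun i => p.1 (lift p.2 i)].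
pose Psi' j (s' : {ffun 'I_d -> 'I_r}) y :=
  \sum_(p : T * 'I_d.+1 | incrb p.1 && (drop p == s')) H (j, p.1) p.2 (spread \o insert p.2 y).
(* Sets of size [d.+1] receive the new lacunary parts; the others keep their old terms, restricted
   along [e]. *)
pose G' j (L : {set 'I_r}) : ('I_r -> nat) -> R := if #|L| == d.+1 then
    (if [pick s : T | incrb s && (image_set s == L)] is Some s
     then fun a => Ft (j, s) (spread \o (fun i => a (s i))) else fun=> 0)
  else fun a => G j L (e \o a).
have comp_s M' a (s : T) : bounded_increasing M' a -> incrb s -> 
    increasing (fun i => a (s i)) /\ forall i, (a (s i) < M')%N.
  by move=> [ai aM] /incrbP si; split=> // i j ij; apply: ai; exact: si.
have st : level_sum M2 Psi' G' (fun j a => g j (e \o a)).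
  split.
  - move=> j L a b ab; rewrite /G'; case: eqP => _; last by apply: sup => i iL /=; rewrite ab.
    case: pickP => // s /andP[_ /eqP sL]; congr Ft; apply: functional_extensionality => i /=.
    by rewrite ab // -sL imset_f.
  - move=> j L; rewrite /G'; case: eqP => _; last exact: lacunary_comp eM (lac j L).
    case: pickP => [s /andP[si /eqP sL]|_] k kL; last by exists true => *; rewrite normr0 mulr0.
    move: kL; rewrite -sL => /imsetP[k' _ ->].
    have [_ _ hl] := HFt (j, s); exists (up (j, s) k') => a b ha hb ab abk.
    have [asi asM] := comp_s _ _ _ ha si; have [bsi bsM] := comp_s _ _ _ hb si.
    apply: hl => // i ik; apply: ab; by rewrite (inj_eq (incrb_inj si)).
  - move=> j a ha; rewrite gE; last exact: bounded_increasing_comp eM ha.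
    have PsiE (s : T) : incrb s -> Psi j s (fun i => (e \o a) (s i)) =
        Ft (j, s) (spread \o (fun i => a (s i))) + \sum_k H (j, s) k (spread \o (fun i => a (s i))).
      move=> si; have [_ hE _] := HFt (j, s); have [asi asM] := comp_s _ _ _ ha si.
      rewrite -hE // => [i k ik|i] /=; last by case: sM => _; apply.
      by case: sM => s1 _; apply: s1 => //; exact: asi.
    rewrite (eq_bigr _ PsiE) big_split /=.
    have -> : \sum_(s : T | incrb s) \sum_k H (j, s) k (spread \o (fun i => a (s i))) =
        \sum_(s : {ffun 'I_d -> 'I_r} | incrb s) Psi' j s (fun i => a (s i)).
      rewrite pair_big /=.
      rewrite (partition_big drop (fun s : {ffun 'I_d -> 'I_r} => incrb s)) /=; last first.
        by move=> p /andP[pi _]; exact: incrb_lift.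
      apply: eq_bigr => s' _; apply: eq_big => [p|p /andP[_ /eqP <-]]; first by rewrite andbT.
      have [Hk _ _] := HFt (j, p.1); apply: Hk => i ik /=; congr spread.
      rewrite /insert; case: unliftP => [i' ->|ik'] /=; first by rewrite ffunE.
      by rewrite ik' eqxx in ik.
    rewrite sum_incrb_image addrAC [RHS]addrC; congr (_ + _).
    rewrite [RHS](bigID (fun L : {set 'I_r} => #|L| == d.+1)) /=; congr (_ + _).
      apply: eq_big => L; first by case: eqP => [->|_]; rewrite ?andbF // ltnSn dD.
      by move=> /eqP Ld; rewrite /G' Ld eqxx; case: pickP.
    apply: eq_big => L; last by rewrite /G' => /andP[dL _]; rewrite gtn_eqF.
    by rewrite (ltn_neqAle d.+1) eq_sym; case: (d < _)%N; case: (_ <= D)%N; case: (_ == _).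
have [e2 [e2M hom]] := HC n n0 M2 (eq_leq (esym M2E)) _ _ _ st.
exists (e \o e2); split; last exact: hom.
case: eM e2M => [s1 s2] [t1 t2]; split=> [x y xy yM|x xM] /=; last by apply: s2; exact: t2.
by apply: s1; [exact: t1|exact: t2].
Qed.

(** Height $2D$ at level 0, plus $\sum_{i<d}(2i+2)=d(d+1)$. *)
Lemma ramsey_level_all d : (0 < D)%N -> (0 < r)%N -> (d <= D)%N -> ramsey_level d (2 * D + d * d.+1).
Proof.
move=> D0 r0; elim: d => [|d IH] dD; first by rewrite mul0n addn0; exact: ramsey_level0.
rewrite (_ : 2 * D + d.+1 * d.+2 = 2 * D + d * d.+1 + (2 * d + 2))%N; last by clear; lia.
by apply: ramsey_levelS => //; [rewrite addn_gt0 muln_gt0 D0|exact: IH (ltnW dD)].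
Qed.
End Levels.

(** * From real towers and increasing tuples to hypergraphs *)

Lemma tw_natr k x : tw k x%:R = (twn k x)%:R.
Proof.
elim: k => [|[|k] IH] //.
have -> : tw k.+2 x%:R = Rpower 2 (tw k.+1 x%:R) by [].
rewrite IH -INRE Rpower_pow; last by have h : 0 < 2 :> R; [rewrite ltr0n|exact/RltP].
by rewrite RpowE twnSS natrX.
Qed.

(** Edges are described through increasing tuples; listing the preimage of [A] in order supplies
    one. *)
Lemma subset_image_increasing (V : finType) n r (p : 'I_n -> V) (A : {set V}) :
  injective p -> A \subset [set p x | x : 'I_n] -> #|A| = r ->
  exists a : 'I_r -> 'I_n, incr a /\ A = [set p (a i) | i : 'I_r].
Proof.
move=> pi AS Ar; pose X := [set x | p x \in A].
have AX : A = p @: X.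
  apply/setP => v; apply/idP/imsetP => [vA|[x + ->]]; last by rewrite inE.
  by have /imsetP[x _ vE] := subsetP AS v vA; exists x; rewrite // inE -vE.
have Xr : #|X| = r by rewrite -Ar AX card_imset.
have sX : sorted ltn [seq val x | x <- enum X].
  rewrite sorted_map {1}/enum_mem; apply: sorted_filter; first by move=> a b c /=; exact: ltn_trans.
  by have := iota_ltn_sorted 0 n; rewrite -val_enum_ord sorted_map enumT.
exists (fun i => enum_val (cast_ord (esym Xr) i)); split=> [i j ij|].
  move x0E : (enum_val (cast_ord (esym Xr) i)) => x0; rewrite -{}x0E.
  rewrite !(enum_val_nth x0) /=.
  rewrite -!(nth_map x0 (val x0) val) -?cardE ?Xr //.
  by apply: (sorted_ltn_nth ltn_trans) => //; rewrite inE size_map -cardE Xr.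
rewrite AX; apply/setP => v; apply/imsetP/imsetP => [[x xX ->]|[i _ ->]].
  by exists (cast_ord Xr (enum_rank_in xX x)) => //; rewrite cast_ordK enum_rankK_in.
by exists (enum_val (cast_ord (esym Xr) i)) => //; exact: enum_valP.
Qed.

Theorem theorem5p5 (r D m : nat) :
  (0 < r)%N -> (0 < D)%N -> (0 < m)%N ->
  let K := (D * (D ^ 2 + 6 * D + 1) %/ 2)%N in
  exists C : R, 0 < C /\
    forall n : nat, (0 < n)%N ->
    forall (V : finType) (E : {set {set V}}),
      quasi_algebraic r D m E ->
      tw K (C * n%:R) <= #|V|%:R ->
      exists S : {set V}, #|S| = n /\ (is_clique r E S \/ is_independent E S).
Proof.
move=> r0 D0 m0 K.
have [C [C0 HC]] := ramsey_level_all R 'I_m D0 r0 (leqnn D).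
exists C%:R; split; first by rewrite ltr0n.
move=> n n0 V E [Eunif [g [f [Gamma [gbij [fdep edgeE]]]]]].
rewrite RmultE -natrM tw_natr ler_nat => KV.
(* $D^2+3D\le K$, with equality at $D=1$. *)
have KD : (2 * D + D * D.+1 <= K)%N.
  by rewrite /K leq_divRL //; move: D0; clear; nia.
have V0 : (0 < #|V|)%N.
  by apply: leq_trans (leq_trans (twn_ge K _) KV); rewrite muln_gt0 C0.
(* Values from [#|V|] on go to a default; the tuples evaluated stay below it. *)
pose toV t : 'I_#|V| := insubd (Ordinal V0) t.
have toVE t : (t < #|V|)%N -> toV t = t :> nat by move=> tV; rewrite /toV val_insubd tV.
have /fin_all_exists[phi phiE] := fdep.
pose Psi j (s : {ffun 'I_D -> 'I_r}) (y : 'I_D -> nat) := phi j s (fun i => toV (y i)).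
(* At level [D] no size satisfies $D<|L|\le D$, so the zero family serves as [G]. *)
have [||e [eM hom]] := HC n n0 #|V| _ Psi (fun _ _ _ => 0) (fun j a => f j (toV \o a)).
- apply: leq_trans KV; apply: twn_monok KD; by rewrite addn_gt0 muln_gt0 D0.
- split=> // [j L k kL|j a [ai aV]]; first by exists true => *; rewrite normr0 mulr0.
  rewrite [X in _ = _ + X]big1 // addr0 phiE // => i k ik /=.
  by rewrite !toVE //; exact: ai.
have [ei ev] := eM.
pose p (x : 'I_n) := g (toV (e x)).
have pinj : injective p.
  move=> x y /(bij_inj gbij) /(congr1 val) /=; rewrite !toVE ?ev // => exy.
  by apply: val_inj => /=; case: (ltngtP x y) => // /ei; rewrite exy ltnn => /(_ (ltn_ord _)).
pose S := [set p x | x : 'I_n].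
have edge (A : {set V}) : A \subset S -> #|A| = r -> exists a, bounded_increasing n a /\
    (A \in E) = Gamma (fun j => f j (toV \o (e \o a)) <= 0).
  move=> AS Ar; have [a [ai ->]] := subset_image_increasing pinj AS Ar.
  exists (fun i => a i : nat); split; first by split=> // i j; exact: ai.
  rewrite -(edgeE (toV \o (e \o (fun i => a i : nat)))) // => i j ij /=.
  by rewrite !toVE ?ev //; apply: ei => //; exact: ai.
exists S; split; first by rewrite card_imset // card_ord.
(* All [r]-subsets of [S] give [Gamma] the same truth values, so one edge inside [S] makes [S] a
   clique. *)
have [/existsP[A /andP[AE AS]]|none] := boolP [exists A : {set V}, (A \in E) && (A \subset S)];
    [left|right].
  move=> B BS Br; have [a [ha aE]] := edge A AS (Eunif A AE); have [b [hb bE]] := edge B BS Br.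
  suff <- : (A \in E) = (B \in E) by [].
  rewrite aE bE; congr Gamma; apply: functional_extensionality => j; exact: hom.
by move=> A AE; apply: contraNN none => AS; apply/existsP; exists A; rewrite AE.
Qed.
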